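(* Let $C=V(g)\subset\mathbb{P}^2$ be a reduced free curve, not a set of concurrent lines, such that $g$ has a linear Jacobian syzygy. If $C$ has some non quasi-homogeneous singularity, then $C$ is either an even or an odd P\l oski curve.
   Context: Let $R=\mathbb{C}[x,y,z]$ and let $g\in R$ be homogeneous of degree $n$. A linear Jacobian syzygy of $g$ is a triple $(A,B,C)\ne(0,0,0)$ of linear forms (some possibly zero) with $A\,\partial_xg+B\,\partial_yg+C\,\partial_zg=0$. A reduced singular plane curve $V(g)$ is free if the graded $R$-module $\mathrm{Syz}(J_g)=\{(A,B,C)\in R^3\mid A\,\partial_xg+B\,\partial_yg+C\,\partial_zg=0\}$ is free. A set of concurrent lines is a union of lines through a common point. An isolated hypersurface singularity is quasi-homogeneous if there is a holomorphic change of variables so that a local defining equation is weighted homogeneous. Here $f(y_1,\dots,y_m)=\sum c_{i_1\cdots i_m}y_1^{i_1}\cdots y_m^{i_m}$ is weighted homogeneous if there exist rational numbers $\alpha_1,\dots,\alpha_m$ such that $\sum c_{i_1\cdots i_m}y_1^{i_1\alpha_1}\cdots y_m^{i_m\alpha_m}$ is homogeneous. A P\l oski curve of degree $n$ is: if $n$ is even (even P\l oski curve), a union of conics belonging to a hyperosculating pencil; if $n$ is odd (odd P\l oski curve), a union of conics belonging to a hyperosculating pencil together with their common tangent line. Up to a projectivity, a hyperosculating pencil of conics is the pencil spanned by $y^2-2xz$ and $z^2$ (its smooth members meet pairwise only at one point, with multiplicity $4$), with common tangent line $z=0$. *)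

(* Defs.v *)
From HB Require Import structures.
From mathcomp Require Import all_boot all_order all_algebra.
From mathcomp Require Import all_classical all_reals all_analysis.
From mathcomp Require Import complex.
(* The notations of mpoly clash with those of the analysis library. *)
From mathcomp Require Import -(notations) mpoly.

Set Implicit Arguments.
Unset Strict Implicit.
Unset Printing Implicit Defensive.

Import Order.TTheory GRing.Theory Num.Theory.
Import numFieldNormedType.Exports.
Local Open Scope classical_set_scope.
Local Open Scope ring_scope.

Section PlaneCurves.
(* Meant for the complex numbers R[i] over R : realType. *)
Variable C : numClosedFieldType.

Implicit Types (g : mpoly 3 C) (p : 'I_3 -> C).

Definition poly_homogeneous (n d : nat) (g : mpoly n C) : Prop :=
  g \is ishomog1 d (@mdeg n).

Definition plane_curve (n : nat) g : Prop :=
  [/\ (0 < n)%N, g != 0 & poly_homogeneous n g].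

Definition reduced_curve g : Prop :=
  forall h q : mpoly 3 C, g = q * h ^+ 2 -> exists c : C, h = mpolyC 3 c.

Definition Syz g (v : 'I_3 -> mpoly 3 C) : Prop :=
  \sum_i v i * mderiv i g = 0.

Definition free_curve g : Prop :=
  exists (r : nat) (b : 'I_r -> 'I_3 -> mpoly 3 C),
    (forall j, Syz g (b j)) /\
    forall v, Syz g v ->
      exists! c : {ffun 'I_r -> mpoly 3 C},
        forall i, v i = \sum_j c j * b j i.

Definition has_linear_syzygy g : Prop :=
  exists v : 'I_3 -> mpoly 3 C,
    [/\ forall i, poly_homogeneous 1 (v i), exists i, v i != 0 & Syz g v].

Definition concurrent_lines g : Prop :=
  exists (p : 'I_3 -> C) (s : seq (mpoly 3 C)),
    [/\ exists i, p i != 0,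
        forall l, l \in s -> poly_homogeneous 1 l /\ meval p l = 0
      & g = \prod_(l <- s) l].

Definition singular_point g p : Prop :=
  [/\ exists i, p i != 0, meval p g = 0 & forall i, meval p (mderiv i g) = 0].

(* The equation of V(g) in the affine chart of P^2 where the k-th coordinate is
   1, translated so that the origin is the point p (whose k-th coordinate is
   assumed to be nonzero). *)
Definition local_equation g p (k : 'I_3) (w : 'rV[C]_2) : C :=
  meval (fun j => if unlift k j is Some i then p j / p k + w ord0 i else 1) g.

Definition holomorphic_near0 (W : normedModType C) (f : 'rV[C]_2 -> W) : Prop :=
  \forall w \near (0 : 'rV[C]_2), differentiable f w.

Definition change_of_variables (phi : 'rV[C]_2 -> 'rV[C]_2) : Prop :=
  exists psi : 'rV[C]_2 -> 'rV[C]_2,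
    [/\ phi 0 = 0 /\ psi 0 = 0,
        holomorphic_near0 phi, holomorphic_near0 psi,
        \forall w \near (0 : 'rV[C]_2), psi (phi w) = w
      & \forall w \near (0 : 'rV[C]_2), phi (psi w) = w].

(* The weights have to be positive: with all weights zero every series would be
   weighted homogeneous.  Since the weights are positive, a weighted homogeneous
   series is a polynomial. *)
Definition weighted_homogeneous (m : nat) (f : mpoly m C) : Prop :=
  exists (a : 'I_m -> rat) (d : rat),
    (forall i, 0 < a i) /\
    forall e, e \in msupp f -> \sum_i (e i)%:R * a i = d.

(* [f] is a defining equation of a germ at the origin; the other ones are the
   products of [f] with a unit [u]. *)
Definition quasi_homogeneous_germ (f : 'rV[C]_2 -> C) : Prop :=
  exists (u : 'rV[C]_2 -> C) (phi : 'rV[C]_2 -> 'rV[C]_2) (h : mpoly 2 C),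
    [/\ holomorphic_near0 u /\ u 0 != 0, change_of_variables phi,
        weighted_homogeneous h
      & \forall w \near (0 : 'rV[C]_2),
          u (phi w) * f (phi w) = meval (fun i => w ord0 i) h].

Definition quasi_homogeneous_at g p : Prop :=
  exists k : 'I_3, p k != 0 /\ quasi_homogeneous_germ (local_equation g p k).

(* The rows of an invertible M are homogeneous coordinates on P^2. *)
Definition coordinate (M : 'M[C]_3) (i : 'I_3) : mpoly 3 C :=
  \sum_j M i j *: mpolyX C (mnm1 j).

(* In the coordinates (x, y, z) given by M, the pencil spanned by y^2 - 2xz and
   z^2 consists, up to scalars, of these conics, which are smooth, and of the
   double line z^2, which is not a component of a reduced curve. *)
Definition hyperosculating_conic (M : 'M[C]_3) (t : C) : mpoly 3 C :=
  let x := coordinate M 0 in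
  let y := coordinate M 1 in
  let z := coordinate M 2%:R in
  y ^+ 2 - 2%:R * x * z + t *: z ^+ 2.

Definition even_ploski (n : nat) g : Prop :=
  ~~ odd n /\
  exists (M : 'M[C]_3) (s : seq C) (c : C),
    [/\ M \in unitmx, (0 < size s)%N, uniq s, c != 0
      & g = c *: \prod_(t <- s) hyperosculating_conic M t].

Definition odd_ploski (n : nat) g : Prop :=
  odd n /\
  exists (M : 'M[C]_3) (s : seq C) (c : C),
    [/\ M \in unitmx, (0 < size s)%N, uniq s, c != 0
      & g = c *: (coordinate M 2%:R *
                  \prod_(t <- s) hyperosculating_conic M t)].
End PlaneCurves.

(* Main.v *)
(* A linear Jacobian syzygy is a linear vector field v = A x with v(g) = 0.  Choose
   coordinates in which A is in Jordan form.
   - If A has a Jordan block of size exactly 2, comparing coefficients shows that g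
     depends on two variables only, so V(g) is a set of concurrent lines.
   - If A has a single block of size 3, its eigenvalue a satisfies a n = 0, so A is
     nilpotent; the kernel of z d/dy + y d/dx is C[y^2 - 2xz, z], hence g is a
     product of conics of the hyperosculating pencil and of a power of z, which
     reducedness bounds by 1: a Ploski curve.
   - If A is diagonal, the exponents of g lie on a line, so that g is a monomial
     times a binary form in two monomials U and V.  At a point with some vanishing
     coordinate the equation is, up to a unit, weighted homogeneous in suitable
     projective coordinates.  At a point with no vanishing coordinate the factors
     U - tV are smooth, so a singularity would produce a square factor (unless some
     coordinate has constant exponent, and then g is a power of this coordinate
     times a product of lines).  Hence all singularities are quasi-homogeneous. *)
From HB Require Import structures.
Require Import Defs.
From mathcomp Require Import all_boot all_order all_algebra.
From mathcomp Require Import boolp reals complex ring zify.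
From mathcomp Require Import -(notations) mpoly.

Set Implicit Arguments.
Unset Strict Implicit.
Unset Printing Implicit Defensive.

Import Order.TTheory GRing.Theory Num.Theory.
Local Open Scope ring_scope.

Local Notation var i := (mpolyX _ (mnm1 i)).

(** * Linear substitutions and derivations *)

Definition mxact (C : numClosedFieldType) (M : 'M[C]_3) (x : 'I_3 -> C) : 'I_3 -> C :=
  fun i => \sum_j M i j * x j.

Section Points.
Variable C : numClosedFieldType.
Implicit Types (g : mpoly 3 C) (p x : 'I_3 -> C) (M N : 'M[C]_3).

Lemma mxactM M N x : mxact M (mxact N x) =1 mxact (M *m N) x.
Proof.
move=> i; rewrite /mxact; under eq_bigr do rewrite mulr_sumr.
rewrite exchange_big; apply: eq_bigr => j _; rewrite !mxE mulr_suml.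
by apply: eq_bigr => k _; rewrite mulrA.
Qed.

Lemma mxact1 x : mxact 1%:M x =1 x.
Proof.
move=> i; rewrite /mxact (bigD1 i) //= mxE eqxx mul1r big1 ?addr0 // => j ji.
by rewrite mxE eq_sym (negPf ji) mul0r.
Qed.

Lemma eq_mxact M x x' : x =1 x' -> mxact M x =1 mxact M x'.
Proof. by move=> xx' i; apply: eq_bigr => j _; rewrite xx'. Qed.

Lemma mxactZ M c x i : mxact M (fun j => c * x j) i = c * mxact M x i.
Proof. by rewrite /mxact mulr_sumr; apply: eq_bigr => j _; rewrite mulrCA. Qed.

Lemma meval_homog n g c x : poly_homogeneous n g ->
  meval (fun i => c * x i) g = c ^+ n * meval x g.
Proof.
move=> /dhomogP hg; rewrite !mevalE mulr_sumr [LHS]big_seq [RHS]big_seq.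
apply: eq_bigr => m /hg /= <-; rewrite mulrCA; congr (_ * _).
by rewrite mdegE -prodrXr -big_split /=; apply: eq_bigr => i _; rewrite exprMn.
Qed.
End Points.

Section LinearSubstitution.
Variable C : numClosedFieldType.
Implicit Types (g p q : mpoly 3 C) (M N A T : 'M[C]_3).

Definition lin_sub M : mpoly 3 C -> mpoly 3 C :=
  comp_mpoly [tuple coordinate M i | i < 3].

HB.instance Definition _ M := GRing.RMorphism.on (lin_sub M).
HB.instance Definition _ M := GRing.Linear.on (lin_sub M).

(** The vector field x -> A x acting on polynomials. A linear Jacobian syzygy with coefficient
    matrix A says that it kills g. *)
Definition linear_derivation A g : mpoly 3 C := \sum_i coordinate A i * mderiv i g.

Lemma meval_coordinate M i x : meval x (coordinate M i) = mxact M x i.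
Proof.
by rewrite /coordinate raddf_sum; apply: eq_bigr => j _; rewrite /= mevalZ mevalXU.
Qed.

Lemma meval_lin_sub M g x : meval x (lin_sub M g) = meval (mxact M x) g.
Proof.
rewrite /lin_sub comp_mpoly_meval; apply: meval_eq => i.
by rewrite tnth_mktuple meval_coordinate.
Qed.

Lemma lin_sub_var M i : lin_sub M (var i) = coordinate M i.
Proof. by rewrite /lin_sub comp_mpolyXU -tnth_nth tnth_mktuple. Qed.

Lemma lin_subC M c : lin_sub M (mpolyC 3 c) = mpolyC 3 c.
Proof. exact: comp_mpolyC. Qed.

Lemma coordinateM M N i : coordinate (N *m M) i = \sum_k N i k *: coordinate M k.
Proof.
under [RHS]eq_bigr do rewrite /coordinate scaler_sumr.
rewrite exchange_big; apply: eq_bigr => j _; rewrite mxE scaler_suml.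
by apply: eq_bigr => k _; rewrite scalerA.
Qed.

Lemma lin_sub_coordinate M N i : lin_sub M (coordinate N i) = coordinate (N *m M) i.
Proof.
rewrite coordinateM /coordinate raddf_sum /=.
by under eq_bigr do rewrite linearZ /= lin_sub_var.
Qed.

Lemma coordinate1 i : coordinate 1%:M i = var i :> mpoly 3 C.
Proof.
rewrite /coordinate (bigD1 i) //= mxE eqxx scale1r big1 ?addr0 // => j ji.
by rewrite mxE eq_sym (negPf ji) scale0r.
Qed.

Lemma lin_subM M N g : lin_sub M (lin_sub N g) = lin_sub (N *m M) g.
Proof.
elim/mpolyind: g => [|c m p _ _ IH]; first by rewrite !raddf0.
rewrite !raddfD /= IH; congr (_ + _); rewrite !linearZ /=; congr (_ *: _).
rewrite [mpolyX _ m]mpolyXE_id !rmorph_prod; apply: eq_bigr => i _.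
by rewrite !rmorphXn /= !lin_sub_var lin_sub_coordinate.
Qed.

Lemma lin_sub1 g : lin_sub 1%:M g = g.
Proof.
rewrite -[RHS]comp_mpoly_id; congr comp_mpoly; apply: eq_from_tnth => i.
by rewrite !tnth_mktuple coordinate1.
Qed.

Lemma lin_subK M : M \in unitmx -> cancel (lin_sub M) (lin_sub (invmx M)).
Proof. by move=> Mu g; rewrite lin_subM mulmxV // lin_sub1. Qed.

Lemma lin_subVK M : M \in unitmx -> cancel (lin_sub (invmx M)) (lin_sub M).
Proof. by move=> Mu g; rewrite lin_subM mulVmx // lin_sub1. Qed.

Lemma homog_coordinate M i : poly_homogeneous 1 (coordinate M i).
Proof.
apply: rpred_sum => j _; apply: rpredZ.
by rewrite dhomogX /= mdeg1.
Qed.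

Lemma homog_lin_sub n M g : poly_homogeneous n g -> poly_homogeneous n (lin_sub M g).
Proof.
move=> /dhomogP hg; rewrite [g]mpolyE raddf_sum /= big_seq.
apply: rpred_sum => m /hg <-; rewrite linearZ /=; apply: rpredZ.
rewrite mpolyXE_id rmorph_prod mdegE.
apply: (big_ind2 (fun a b => a \is ishomog1 b (@mdeg 3))).
- exact: dhomog1.
- by move=> a i b j; exact: dhomogM.
move=> i _; rewrite rmorphXn /= lin_sub_var.
by have := dhomogMn (m i) (homog_coordinate M i); rewrite mul1n.
Qed.

Lemma linear_form_coordinate (v : 'I_3 -> mpoly 3 C) :
  (forall i, poly_homogeneous 1 (v i)) ->
  exists A : 'M[C]_3, v =1 coordinate A.
Proof.
move=> hv; exists (\matrix_(i, j) mcoeff (mnm1 j) (v i)) => i.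
apply/mpolyP => m; rewrite /coordinate raddf_sum.
under eq_bigr do rewrite mxE /= mcoeffZ mcoeffX.
have [m1|m1] := boolP (mdeg m == 1%N); last first.
  rewrite (dhomog_nemf_coeff (hv i) m1) big1 // => j _.
  suff /negPf -> : mnm1 j != m by rewrite mulr0.
  by apply: contraNneq m1 => <-; rewrite mdeg1.
have [j /eqP ->] := mdeg1P _ m1.
rewrite (bigD1 j) //= eqxx mulr1 big1 ?addr0 // => k kj.
by rewrite eq_mnm1 (negPf kj) mulr0.
Qed.

(** Chain rule. Both sides are linear in g and obey the same product rule, so it suffices to check 1
    and the variables. *)
Lemma mderiv_lin_sub M k g :
  mderiv k (lin_sub M g) = \sum_i M i k *: lin_sub M (mderiv i g).
Proof.
have D1 p q : mderiv k (lin_sub M p) = \sum_i M i k *: lin_sub M (mderiv i p) ->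
    mderiv k (lin_sub M q) = \sum_i M i k *: lin_sub M (mderiv i q) ->
    mderiv k (lin_sub M (p * q)) = \sum_i M i k *: lin_sub M (mderiv i (p * q)).
  move=> dp dq; rewrite rmorphM mderivM dp dq mulr_suml mulr_sumr -big_split.
  apply: eq_bigr => i _; rewrite mderivM rmorphD !rmorphM /= scalerDr.
  by rewrite scalerAl scalerAr.
elim/mpolyind: g => [|c m p _ _ IH].
  by rewrite raddf0 mderiv0 big1 // => i _; rewrite mderiv0 raddf0 scaler0.
rewrite raddfD /= mderivD IH; under [RHS]eq_bigr do rewrite mderivD raddfD scalerDr.
rewrite big_split; congr (_ + _); rewrite linearZ /= mderivZ.
under [RHS]eq_bigr do rewrite mderivZ linearZ /= scalerA mulrC -scalerA.
rewrite -scaler_sumr; congr (_ *: _); rewrite mpolyXE_id.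
have D0 : mderiv k (lin_sub M 1) = \sum_i M i k *: lin_sub M (mderiv i 1).
  rewrite rmorph1 -[1]/(mpolyC 3 1) mderivC big1 // => i _.
  by rewrite mderivC raddf0 scaler0.
apply: (big_ind (fun q => mderiv k (lin_sub M q) =
  \sum_i M i k *: lin_sub M (mderiv i q))) => // i _.
elim: (m i) => [|j IHj]; first by rewrite expr0.
rewrite exprS; apply: D1 => //; rewrite lin_sub_var /coordinate raddf_sum /=.
rewrite (bigD1 k) //= big1 => [|l lk]; last first.
  by rewrite mderivZ mderivX mnm1E (negPf lk) scale0r scaler0.
rewrite [RHS](bigD1 i) //= [X in _ = _ + X]big1 => [|l lk]; last first.
  by rewrite mderivX mnm1E eq_sym (negPf lk) scale0r raddf0 scaler0.
rewrite !addr0 mderivZ !mderivX !mnm1E !eqxx !scale1r.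
have UU a : mnm_sub (mnm1 a) (mnm1 a) = mnm0 :> multinom 3.
  by apply/mnmP => l; rewrite mnmBE mnm0E subnn.
by rewrite !UU mpolyX0 rmorph1.
Qed.

(** By the chain rule: [M *m A = T *m M] says that the field has matrix T in the coordinates given
    by M. This carries the syzygy to Jordan form. *)
Lemma linear_derivation_lin_sub M A T g : M *m A = T *m M ->
  linear_derivation A (lin_sub M g) = lin_sub M (linear_derivation T g).
Proof.
move=> MA; rewrite /linear_derivation raddf_sum /=.
under eq_bigr do rewrite mderiv_lin_sub mulr_sumr.
rewrite exchange_big; apply: eq_bigr => i _.
rewrite rmorphM /= lin_sub_coordinate -MA coordinateM mulr_suml.
by apply: eq_bigr => k _; rewrite -scalerAr scalerAl.
Qed.

End LinearSubstitution.

(** * Jordan normal form of a 3 x 3 matrix *)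

Section NormalForm.

Definition mx3 (F : fieldType) (a b c d e f g h i : F) : 'M[F]_3 :=
  \matrix_(k, l) nth 0 (nth [::] [:: [:: a; b; c]; [:: d; e; f]; [:: g; h; i]] k) l.

Lemma ord3P (P : 'I_3 -> Prop) : P 0 -> P 1 -> P 2%:R -> forall i, P i.
Proof.
move=> P0 P1 P2 [[|[|[|//]]] hi].
- by rewrite (_ : Ordinal hi = 0) //; exact: val_inj.
- by rewrite (_ : Ordinal hi = 1) //; exact: val_inj.
- by rewrite (_ : Ordinal hi = 2%:R) //; exact: val_inj.
Qed.

Lemma mx3E (F : fieldType) (M : 'M[F]_3) :
  M = mx3 (M 0 0) (M 0 1) (M 0 2%:R) (M 1 0) (M 1 1) (M 1 2%:R)
          (M 2%:R 0) (M 2%:R 1) (M 2%:R 2%:R).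
Proof. by apply/matrixP; apply: ord3P; apply: ord3P; rewrite mxE. Qed.

Lemma sum3E (V : nmodType) (f : 'I_3 -> V) : \sum_i f i = f 0 + f 1 + f 2%:R.
Proof.
rewrite !big_ord_recl big_ord0 addr0 addrA.
by congr (_ + f _ + f _); exact: val_inj.
Qed.

Variable F : fieldType.

Lemma mulmx3 (a b c d e f g h i a' b' c' d' e' f' g' h' i' : F) :
  mx3 a b c d e f g h i *m mx3 a' b' c' d' e' f' g' h' i' =
  mx3 (a * a' + b * d' + c * g') (a * b' + b * e' + c * h') (a * c' + b * f' + c * i')
      (d * a' + e * d' + f * g') (d * b' + e * e' + f * h') (d * c' + e * f' + f * i')
      (g * a' + h * d' + i * g') (g * b' + h * e' + i * h') (g * c' + h * f' + i * i').
Proof.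
by apply/matrixP; apply: ord3P; apply: ord3P; rewrite !mxE sum3E !mxE.
Qed.

Lemma det_mx2 (M : 'M[F]_2) : \det M = M 0 0 * M 1 1 - M 0 1 * M 1 0.
Proof.
have l0 : lift (0 : 'I_2) (0 : 'I_1) = 1 by exact: val_inj.
have l1 : lift (1 : 'I_2) (0 : 'I_1) = 0 by exact: val_inj.
rewrite (expand_det_row _ 0) !big_ord_recl big_ord0 /cofactor !det_mx11 !mxE.
by rewrite !l0 l1 expr0 expr1 mul1r mulN1r mulrN addr0.
Qed.

Lemma det_mx3 (a b c d e f g h i : F) : \det (mx3 a b c d e f g h i) =
  a * (e * i - f * h) - b * (d * i - f * g) + c * (d * h - e * g).
Proof.
rewrite (expand_det_row _ 0) sum3E /cofactor !det_mx2 !mxE /=; ring.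
Qed.

Lemma mx3_unit (a b c d e f g h i : F) :
  a * (e * i - f * h) - b * (d * i - f * g) + c * (d * h - e * g) != 0 ->
  mx3 a b c d e f g h i \in unitmx.
Proof. by rewrite unitmxE unitfE det_mx3. Qed.

(** In the second form [c] may equal [a], which covers blocks of sizes 2 and 1 with the same
    eigenvalue. *)
Definition jordan3 (T : 'M[F]_3) : Prop :=
  [\/ exists a b c, T = mx3 a 0 0 0 b 0 0 0 c,
      exists a c, T = mx3 a 1 0 0 a 0 0 0 c
    | exists a, T = mx3 a 1 0 0 a 1 0 0 a].

Definition jordanizable (A : 'M[F]_3) : Prop :=
  exists M T : 'M[F]_3, [/\ M \in unitmx, M *m A = T *m M & jordan3 T].

Lemma jordanizable_similar (P A B : 'M[F]_3) :
  P \in unitmx -> P *m A = B *m P -> jordanizable B -> jordanizable A.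
Proof.
move=> Pu PA [M [T [Mu MB JT]]]; exists (M *m P), T; split=> //.
  by rewrite unitmx_mul Mu.
by rewrite -mulmxA PA mulmxA MB mulmxA.
Qed.

(** The rows of each base change are left eigenvectors of the triangular matrix, possibly
    generalized. They are found by back substitution, according to which eigenvalues coincide. *)
Lemma jordanizable_trig (a b c u v w : F) : jordanizable (mx3 a 0 0 u b 0 v w c).
Proof.
have dI x y : x != y -> x - y != 0 :> F by rewrite subr_eq0.
have [ab|ab] := eqVneq a b; have [bc|bc] := eqVneq b c; [subst b c|subst b|subst c|].
(* One eigenvalue: the nilpotent part has square [w * u] in a corner, so there is a full block
   exactly when [u] and [w] are nonzero. *)
- have [u0|u0] := eqVneq u 0; have [w0|w0] := eqVneq w 0.
  + subst u w; have [v0|v0] := eqVneq v 0.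
      subst v; exists 1%:M, (mx3 a 0 0 0 a 0 0 0 a).
      by split; rewrite ?unitmx1 ?mulmx1 ?mul1mx //; constructor 1; exists a, a, a.
    exists (mx3 0 0 1 v 0 0 0 1 0), (mx3 a 1 0 0 a 0 0 0 a).
    split; [apply: mx3_unit|rewrite !mulmx3; congr mx3; ring
      |by constructor 2; exists a, a].
    by rewrite (_ : _ + _ = v) //; ring.
  + subst u; exists (mx3 0 0 1 v w 0 1 0 0), (mx3 a 1 0 0 a 0 0 0 a).
    split; [apply: mx3_unit|rewrite !mulmx3; congr mx3; ring
      |by constructor 2; exists a, a].
    by rewrite (_ : _ + _ = - w) ?oppr_eq0 //; ring.
  + subst w; exists (mx3 0 1 0 u 0 0 0 (- v) u), (mx3 a 1 0 0 a 0 0 0 a).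
    split; [apply: mx3_unit|rewrite !mulmx3; congr mx3; ring
      |by constructor 2; exists a, a].
    by rewrite (_ : _ + _ = - (u * u)) ?oppr_eq0 ?mulf_neq0 //; ring.
  + exists (mx3 0 0 1 v w 0 (w * u) 0 0), (mx3 a 1 0 0 a 1 0 0 a).
    split; [apply: mx3_unit|rewrite !mulmx3; congr mx3; ring
      |by constructor 3; exists a].
    by rewrite (_ : _ + _ = - (w * (w * u))) ?oppr_eq0 ?mulf_neq0 //; ring.
(* Here a = b: [(t, r, 1)] is the left eigenvector for [c], and [u] decides whether the double
   eigenvalue splits. *)
- have ca : c - a != 0 by rewrite dI // eq_sym.
  pose r := w / (c - a); pose t := (v + r * u) / (c - a).
  have [u0|u0] := eqVneq u 0.
    subst u; exists (mx3 1 0 0 0 1 0 t r 1), (mx3 a 0 0 0 a 0 0 0 c).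
    split; [apply: mx3_unit|rewrite !mulmx3 /t /r; congr mx3; by field
      |by constructor 1; exists a, a, c].
    by rewrite (_ : _ + _ = 1) ?oner_eq0 //; ring.
  exists (mx3 0 1 0 u 0 0 t r 1), (mx3 a 1 0 0 a 0 0 0 c).
  split; [apply: mx3_unit|rewrite !mulmx3 /t /r; congr mx3; by field
      |by constructor 2; exists a, c].
  by rewrite (_ : _ + _ = - u) ?oppr_eq0 //; ring.
(* Here b = c, and [w] decides whether the double eigenvalue splits. *)
- have ba : b - a != 0 by rewrite dI // eq_sym.
  pose s := u / (b - a); pose t := (v - w * s) / (b - a).
  have [w0|w0] := eqVneq w 0.
    subst w; exists (mx3 1 0 0 s 1 0 t 0 1), (mx3 a 0 0 0 b 0 0 0 b).
    split; [apply: mx3_unit|rewrite !mulmx3 /t /s; congr mx3; by field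
      |by constructor 1; exists a, b, b].
    by rewrite (_ : _ + _ = 1) ?oner_eq0 //; ring.
  exists (mx3 t 0 1 (w * s) w 0 1 0 0), (mx3 b 1 0 0 b 0 0 0 a).
  split; [apply: mx3_unit|rewrite !mulmx3 /t /s; congr mx3; by field
      |by constructor 2; exists b, a].
  by rewrite (_ : _ + _ = - w) ?oppr_eq0 //; ring.
have ba : b - a != 0 by rewrite dI // eq_sym.
have cb : c - b != 0 by rewrite dI // eq_sym.
pose s := u / (b - a).
have [ac|ac] := eqVneq a c.
  (* The row [(r * s, r, 1)] is sent to [a] times itself plus [k] times [(1, 0, 0)], so [k] is the
     obstruction to diagonalizing. *)
  subst c; pose r := w / (a - b); pose k := v - w * s.
  have ab' : a - b != 0 by rewrite dI.
  have [k0|k0] := eqVneq k 0.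
    exists (mx3 1 0 0 s 1 0 (r * s) r 1), (mx3 a 0 0 0 b 0 0 0 a).
    split; [apply: mx3_unit| |by constructor 1; exists a, b, a].
      by rewrite (_ : _ + _ = 1) ?oner_eq0 //; ring.
    have vE : v = w * s by apply/eqP; rewrite -subr_eq0 -/k k0.
    by rewrite vE !mulmx3 /r /s; congr mx3; field; rewrite ?ba ?ab'.
  exists (mx3 (r * s) r 1 k 0 0 s 1 0), (mx3 a 1 0 0 a 0 0 0 b).
  split; [apply: mx3_unit| |by constructor 2; exists a, b].
    by rewrite (_ : _ + _ = k) //; ring.
  by rewrite !mulmx3 /k /r /s; congr mx3; field; rewrite ?ba ?ab'.
have ca : c - a != 0 by rewrite dI // eq_sym.
pose r := w / (c - b); pose t := (v + r * u) / (c - a).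
exists (mx3 1 0 0 s 1 0 t r 1), (mx3 a 0 0 0 b 0 0 0 c).
split; [apply: mx3_unit| |by constructor 1; exists a, b, c].
  by rewrite (_ : _ + _ = 1) ?oner_eq0 //; ring.
by rewrite !mulmx3 /t /r /s; congr mx3; field; rewrite ?ba ?ca ?cb.
Qed.
End NormalForm.

Lemma jordanizable_closed (C : numClosedFieldType) (A : 'M[C]_3) : jordanizable A.
Proof.
have [P Pu] := Schur A (isT : (0 < 3)%N); have {}Pu := unitarymx_unit Pu.
rewrite /similar_to conjumx // => /is_trig_mxP trig.
set B := (P *m A *m invmx P) in trig.
apply: (jordanizable_similar (B := B) Pu); first by rewrite /B -!mulmxA mulVmx ?mulmx1.
have t01 : B 0 1 = 0 by exact: trig.
have t02 : B 0 2%:R = 0 by exact: trig.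
have t12 : B 1 2%:R = 0 by exact: trig.
by rewrite [B]mx3E t01 t02 t12; exact: jordanizable_trig.
Qed.

(** * Coefficients and factorizations *)

Section BinaryForm.
Variables (C : closedFieldType) (A : comAlgType C).

(** Dehomogenization: each root t of P gives a factor U - tV, and the defect of the degree of P from
    Q gives the power of V. U and V lie in any commutative algebra, so that monomials and conics can
    be substituted. *)
Lemma binary_form_split (U V : A) Q (P : {poly C}) :
  P != 0 -> (size P <= Q.+1)%N ->
  exists (c : C) (r : nat) (rs : seq C), [/\ c != 0, (r + size rs)%N = Q &
    \sum_(s < Q.+1) P`_s *: (U ^+ s * V ^+ (Q - s)) =
    c *: (V ^+ r * \prod_(t <- rs) (U - t *: V))].
Proof.
move=> P0 sP; have [rs PE] := closed_field_poly_normal P.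
have szP : size P = (size rs).+1.
  by rewrite PE size_scale ?lead_coef_eq0 // size_prod_XsubC.
have rsQ : (size rs <= Q)%N by rewrite -ltnS -szP.
exists (lead_coef P), (Q - size rs)%N, rs; split; rewrite ?lead_coef_eq0 ?subnK //.
under [LHS]eq_bigr do rewrite {1}PE coefZ -scalerA.
rewrite -scaler_sumr; congr (_ *: _).
move: {P P0 sP PE szP} rsQ => /subnK; move: (Q - _)%N => r <- {Q}.
elim: rs => [|t rs IH] /=.
  rewrite !big_nil addn0 mulr1 big_ord_recl coef1 scale1r expr0 mul1r subn0.
  by rewrite big1 ?addr0 // => i _; rewrite coef1 scale0r.
(* Multiplying [p] by X - t multiplies the form by U - tV: the X part shifts the index, while the t
   part loses its top term because [p] has degree at most [Q]. *)
rewrite addnS; set Q := (r + size rs)%N in IH *.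
rewrite !big_cons mulrCA -IH; set p := \prod_(z <- rs) _.
have pQ : p`_Q.+1 = 0.
  by apply: nth_default; rewrite size_prod_XsubC /= ltnS leq_addl.
rewrite [RHS]mulrBl -scalerAl !mulr_sumr scaler_sumr.
under [LHS]eq_bigr do rewrite mulrBl coefB coefXM mul_polyC coefZ scalerBl.
rewrite sumrB; congr (_ - _).
  rewrite big_ord_recl scale0r add0r; apply: eq_bigr => i _.
  by rewrite /= subSS exprS -mulrA scalerAr.
rewrite big_ord_recr /= pQ mulr0 scale0r addr0; apply: eq_bigr => i _.
have iQ : (i <= Q)%N by rewrite -ltnS.
by rewrite subSn // exprS -scalerA mulrCA -scalerAr.
Qed.
End BinaryForm.

(** * Coefficients of a polynomial killed by a triangular derivation *)

Section Coefficients.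
Variable C : numClosedFieldType.
Implicit Types (g p q G : mpoly 3 C) (m : multinom 3).

Definition mnm3 i j k : multinom 3 := Multinom [tuple i; j; k].

Lemma mnm3_0 i j k : mnm3 i j k 0 = i. Proof. by []. Qed.
Lemma mnm3_1 i j k : mnm3 i j k 1 = j. Proof. by []. Qed.
Lemma mnm3_2 i j k : mnm3 i j k 2%:R = k. Proof. by []. Qed.
Definition mnm3S := (mnm3_0, mnm3_1, mnm3_2).

Lemma mnm3E m : m = mnm3 (m 0) (m 1) (m 2%:R).
Proof. by apply/mnmP; apply: ord3P; rewrite !mnm3S. Qed.

Lemma mdeg_mnm3 i j k : mdeg (mnm3 i j k) = (i + j + k)%N.
Proof. by rewrite mdegE !big_ord_recl big_ord0 addn0 addnA. Qed.

Lemma mcoeff_mulvar m i p :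
  mcoeff m (var i * p) = if m i == 0%N then 0 else mcoeff (mnm_sub m (mnm1 i)) p.
Proof.
rewrite mulrC; case: eqP => [mi|/eqP mi].
  apply: memN_msupp_eq0; rewrite (perm_mem (msuppMX _ _)).
  apply/mapP => -[m' _ E]; have := congr1 (fun m => m i) E.
  by rewrite mi mnmDE mnm1E eqxx.
rewrite -[in LHS](submK (m := mnm1 i) (m' := m)) ?lep1mP //.
by rewrite addmC mcoeffMX.
Qed.

Lemma mcoeff_mulvar_mderiv m i g :
  mcoeff m (var i * mderiv i g) = (m i)%:R * mcoeff m g.
Proof.
rewrite mcoeff_mulvar; case: eqP => [->|/eqP mi]; first by rewrite mul0r.
rewrite mcoeff_mderiv submK ?lep1mP // mnmBE mnm1E eqxx subn1 prednK ?lt0n //.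
by rewrite mulr_natl.
Qed.

Lemma mcoeff_x1d0 i j k g :
  mcoeff (mnm3 i j k) (var 1 * mderiv 0 g) =
  if j is j'.+1 then i.+1%:R * mcoeff (mnm3 i.+1 j' k) g else 0.
Proof.
rewrite mcoeff_mulvar mnm3S; case: j => // j; rewrite mcoeff_mderiv mulr_natl.
have -> : mnm_add (mnm_sub (mnm3 i j.+1 k) (mnm1 1)) (mnm1 0) = mnm3 i.+1 j k.
  by apply/mnmP; apply: ord3P; rewrite mnmDE mnmBE !mnm1E !mnm3S /=; lia.
by rewrite mnmBE mnm1E mnm3S subn0.
Qed.

Lemma mcoeff_x2d1 i j k g :
  mcoeff (mnm3 i j k) (var 2%:R * mderiv 1 g) =
  if k is k'.+1 then j.+1%:R * mcoeff (mnm3 i j.+1 k') g else 0.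
Proof.
rewrite mcoeff_mulvar mnm3S; case: k => // k; rewrite mcoeff_mderiv mulr_natl.
have -> : mnm_add (mnm_sub (mnm3 i j k.+1) (mnm1 2%:R)) (mnm1 1) = mnm3 i j.+1 k.
  by apply/mnmP; apply: ord3P; rewrite mnmDE mnmBE !mnm1E !mnm3S /=; lia.
by rewrite mnmBE mnm1E mnm3S subn0.
Qed.

Lemma mpoly3P p q :
  (forall i j k, mcoeff (mnm3 i j k) p = mcoeff (mnm3 i j k) q) -> p = q.
Proof. by move=> pq; apply/mpolyP => m; rewrite [m]mnm3E. Qed.

(** The diagonal multiplies each monomial by its weight; the entries [u] and [v] contribute the
    shifts y d/dx and z d/dy. *)
Lemma mcoeff_linear_derivation (a b c u v : C) m G :
  mcoeff m (linear_derivation (mx3 a u 0 0 b v 0 0 c) G) =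
  (a * (m 0)%:R + b * (m 1)%:R + c * (m 2%:R)%:R) * mcoeff m G
  + u * mcoeff m (var 1 * mderiv 0 G) + v * mcoeff m (var 2%:R * mderiv 1 G).
Proof.
rewrite /linear_derivation sum3E /coordinate !sum3E !mxE /= !scale0r !add0r !addr0.
rewrite !mulrDl -!scalerAl !mcoeffD !mcoeffZ !mcoeff_mulvar_mderiv; ring.
Qed.

Lemma homog_coeff n g i j k : poly_homogeneous n g ->
  (i + j + k)%N != n -> mcoeff (mnm3 i j k) g = 0.
Proof. by move=> hg; rewrite -mdeg_mnm3; exact: dhomog_nemf_coeff. Qed.

(* A relation between the coefficients along the direction (1,-1,0): the
   eigenvalue [a * (i + j) + c * k] is constant on it. *)
Lemma jordan_block_coeff0 (a c : C) G :
  linear_derivation (mx3 a 1 0 0 a 0 0 0 c) G = 0 ->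
  forall i j k, mcoeff (mnm3 i.+1 j k) G = 0.
Proof.
move=> dG.
have rel i j k : (a * (i + j)%N%:R + c * k%:R) * mcoeff (mnm3 i j k) G +
    (if j is j'.+1 then i.+1%:R * mcoeff (mnm3 i.+1 j' k) G else 0) = 0.
  have := mcoeff_linear_derivation a a c 1 0 (mnm3 i j k) G.
  rewrite dG mcoeff0 mcoeff_x1d0 !mnm3S => E.
  by rewrite [RHS]E natrD mulrDr mul0r addr0 mul1r.
(* If the eigenvalue is nonzero, the relation at the monomial itself kills its coefficient; if it is
   zero, the relation at the neighbour with one more y and one less x does. *)
move=> i j k; elim: j i => [|j IH] i; last first.
  have := rel i.+1 j.+1 k; rewrite IH mulr0 addr0 => /eqP.
  have := rel i j.+2 k; rewrite addSn -addnS.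
  move=> /eqP; rewrite addr_eq0 mulf_eq0 => r1 /orP[mu|/eqP//].
  by move: r1; rewrite (eqP mu) mul0r eq_sym oppr_eq0 mulf_eq0 pnatr_eq0 => /eqP.
have := rel i.+1 0%N k; have := rel i 1%N k.
rewrite addr0 addn0 addn1 => /eqP; rewrite addr_eq0 => r1 /eqP.
rewrite mulf_eq0 => /orP[mu|/eqP//].
by move: r1; rewrite (eqP mu) mul0r eq_sym oppr_eq0 mulf_eq0 pnatr_eq0 => /eqP.
Qed.

(** In degree n the operator is [a * n] plus terms that involve only coefficients of smaller weight
    j + 2k. If [a] were nonzero, induction on this weight would kill every coefficient. *)
Lemma jordan3_eigenvalue0 (a : C) n G : (0 < n)%N -> poly_homogeneous n G -> G != 0 ->
  linear_derivation (mx3 a 1 0 0 a 1 0 0 a) G = 0 -> a = 0.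
Proof.
move=> n0 hG G0 dG; apply/eqP; apply: contraNT G0 => a0; apply/eqP/mpoly3P => i j k.
rewrite mcoeff0; have [s] := ubnP (j + k.*2)%N; elim: s => // s IH in i j k *.
rewrite ltnS => js; have [ijk|/(homog_coeff hG) //] := eqVneq (i + j + k)%N n.
have := mcoeff_linear_derivation a a a 1 1 (mnm3 i j k) G.
rewrite dG mcoeff0 mcoeff_x1d0 mcoeff_x2d1 !mnm3S -!mulrDr -!natrD ijk.
rewrite !mul1r.
have -> : (if j is j'.+1 then i.+1%:R * mcoeff (mnm3 i.+1 j' k) G else 0) = 0.
  by case: j js {ijk} => // j js; rewrite IH ?mulr0.
have -> : (if k is k'.+1 then j.+1%:R * mcoeff (mnm3 i j.+1 k') G else 0) = 0.
  by case: k js {ijk} => // k js; rewrite IH ?mulr0 //; lia.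
rewrite !addr0 => /esym/eqP; rewrite !mulf_eq0 (negPf a0) pnatr_eq0.
rewrite -[n == 0%N]negbK -lt0n n0.
by move=> /eqP.
Qed.

(** The relations express the coefficients with x-exponent i + 1 through those with x-exponent i,
    and force odd powers of y to vanish. A kernel element is thus determined by its restriction to x
    = 0. *)
Lemma jordan3_kernel_unique G :
  linear_derivation (mx3 0 1 0 0 0 1 0 0 0) G = 0 ->
  (forall j k, mcoeff (mnm3 0 j.*2 k) G = 0) -> G = 0.
Proof.
move=> dG G0.
have rel i j k :
    (if j is j'.+1 then i.+1%:R * mcoeff (mnm3 i.+1 j' k) G else 0) +
    (if k is k'.+1 then j.+1%:R * mcoeff (mnm3 i j.+1 k') G else 0) = 0.
  have := mcoeff_linear_derivation 0 0 0 1 1 (mnm3 i j k) G.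
  by rewrite dG mcoeff0 mcoeff_x1d0 mcoeff_x2d1 !mul0r !add0r mul0r add0r !mul1r.
have nz (s : nat) (x : C) : s.+1%:R * x = 0 -> x = 0.
  by move=> /eqP; rewrite mulf_eq0 pnatr_eq0 => /eqP.
have odd0 j i k : mcoeff (mnm3 i j.*2.+1 k) G = 0.
  elim: j i k => [|j IH] i k; last first.
    by have := rel i j.*2.+2 k.+1; rewrite IH mulr0 add0r doubleS => /nz.
  by have := rel i 0%N k.+1; rewrite add0r => /nz.
have even0 i j k : mcoeff (mnm3 i j.*2 k) G = 0.
  elim: i j k => // i IH j [|k]; have := rel i j.*2.+1.
    by move=> /(_ 0%N); rewrite addr0 => /nz.
  by move=> /(_ k.+1); rewrite -doubleS IH mulr0 addr0 => /nz.
apply: mpoly3P => i j k; rewrite mcoeff0 -(odd_double_half j).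
by case: (odd j); [exact: odd0|exact: even0].
Qed.

End Coefficients.

(** * Factorization along a segment of exponents, and concurrent lines *)

Section Factorization.
Variable C : numClosedFieldType.
Implicit Types (g p q G : mpoly 3 C) (m : multinom 3).

(* If the exponents of [G] lie on a segment, then [G] is a monomial times a binary
   form in two monomials. *)
Lemma binomial_factorization G (e d d' : multinom 3) Q :
  G != 0 -> d != d' ->
  (forall m, m \in msupp G -> exists2 s, (s <= Q)%N &
     m = mnm_add e (mnm_add (mnm_muln d s) (mnm_muln d' (Q - s)))) ->
  exists (c : C) (r : nat) (rs : seq C), [/\ c != 0, (r + size rs)%N = Q &
    G = c *: (mpolyX C e * (mpolyX C d' ^+ r *
              \prod_(t <- rs) (mpolyX C d - t *: mpolyX C d')))].
Proof.
move=> G0 dd' supp.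
pose mm s := mnm_add e (mnm_add (mnm_muln d s) (mnm_muln d' (Q - s))).
have mm_inj s s' : (s <= Q)%N -> (s' <= Q)%N -> mm s = mm s' -> s = s'.
  move=> sQ s'Q E; have [i di] : exists i, d i != d' i.
    apply/existsP; apply: contraNT dd' => /existsPn h; apply/eqP/mnmP => i.
    by apply/eqP; rewrite -[_ == _]negbK.
  have := congr1 (fun m => m i) E; rewrite /mm !mnmDE !mulmnE.
  by move: di; nia.
(* Distinct [s] give distinct exponents, so the coefficients of [G] on the segment are those of one
   univariate polynomial. *)
pose P := \poly_(s < Q.+1) mcoeff (mm s) G.
have GE : G = mpolyX C e *
    \sum_(s < Q.+1) P`_s *: (mpolyX C d ^+ s * mpolyX C d' ^+ (Q - s)).
  rewrite mulr_sumr; under eq_bigr do rewrite -scalerAr !mpolyXn -!mpolyXD.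
  apply/mpolyP => m; rewrite raddf_sum /=.
  under eq_bigr do rewrite mcoeffZ mcoeffX coef_poly ltn_ord -/(mm _).
  have [/supp[s sQ mE]|mG] := boolP (m \in msupp G).
    rewrite (bigD1 (Ordinal (sQ : (s < Q.+1)%N))) //= mE eqxx mulr1 big1 ?addr0 // => i.
    rewrite -val_eqE /= => si; suff /negPf -> : mm i != mm s by rewrite mulr0.
    by apply: contraNneq si => /mm_inj -> //; rewrite -ltnS.
  rewrite (memN_msupp_eq0 mG) big1 // => i _.
  by case: eqP => [->|]; rewrite ?mulr0 // (memN_msupp_eq0 mG) mul0r.
have P0 : P != 0.
  apply: contraNneq G0 => P0; rewrite GE P0 big1 ?mulr0 // => s _.
  by rewrite coef0 scale0r.
have [c [r [rs [c0 rQ E]]]] :=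
  binary_form_split (mpolyX C d) (mpolyX C d') P0 (size_poly _ _).
by exists c, r, rs; split=> //; rewrite [LHS]GE E -scalerAr.
Qed.

Lemma reduced_lin_sub (N : 'M[C]_3) g : N \in unitmx ->
  reduced_curve g -> reduced_curve (lin_sub N g).
Proof.
move=> Nu rg h q E; have [|c hc] := rg (lin_sub (invmx N) h) (lin_sub (invmx N) q).
  by rewrite -rmorphXn -rmorphM /= -E lin_subK.
by exists c; rewrite -(lin_subVK Nu h) hc lin_subC.
Qed.

Lemma homog_var n i : poly_homogeneous 1 (mpolyX C (@mnm1 n i)).
Proof. by rewrite /poly_homogeneous dhomogX /= mdeg1. Qed.

(** The scalar is absorbed into the first line, whence the nonempty list. *)
Lemma concurrent_scaled_prod (p : 'I_3 -> C) (c : C) s :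
  (exists i, p i != 0) ->
  (forall l, l \in s -> poly_homogeneous 1 l /\ meval p l = 0) ->
  (0 < size s)%N -> concurrent_lines (c *: \prod_(l <- s) l).
Proof.
case: s => // l s p0 hs _; exists p, (c *: l :: s); split=> //.
  move=> l'; rewrite in_cons => /orP[/eqP->|l's]; last first.
    by apply: hs; rewrite in_cons l's orbT.
  have [hl pl] := hs l (mem_head _ _); split; last by rewrite mevalZ pl mulr0.
  exact: rpredZ.
by rewrite !big_cons scalerAl.
Qed.

Lemma concurrent_lin_sub (M : 'M[C]_3) G : M \in unitmx ->
  concurrent_lines G -> concurrent_lines (lin_sub M G).
Proof.
move=> Mu [p [s [[i pi] hs ->]]]; exists (mxact (invmx M) p), (map (lin_sub M) s).
split.
- apply/existsP; apply: contraNT pi => /existsPn h.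
  rewrite -[p i]mxact1 -(mulmxV Mu) -mxactM [mxact M _ i]/mxact big1 // => j _.
  by have /negPn/eqP -> := h j; rewrite mulr0.
- move=> _ /mapP[l ls ->]; have [hl pl] := hs l ls; split; first exact: homog_lin_sub.
  rewrite meval_lin_sub -pl; apply: meval_eq => j.
  by rewrite mxactM mulmxV // mxact1.
by rewrite rmorph_prod big_map.
Qed.

(** A form without x is a binary form in y and z, hence splits into lines through (1:0:0). *)
Lemma concurrent_binary_form n G : (0 < n)%N -> poly_homogeneous n G -> G != 0 ->
  (forall i j k, mcoeff (mnm3 i.+1 j k) G = 0) -> concurrent_lines G.
Proof.
move=> n0 hG G0 Gx.
have [||c [r [rs [c0 rn ->]]]] :=
  @binomial_factorization G mnm0 (mnm1 1) (mnm1 2%:R) n G0.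
- by rewrite eq_mnm1.
- move=> m mG; exists (m 1); have := dhomog_mf hG mG; rewrite [m]mnm3E /= mdeg_mnm3 mnm3S.
    by move: mG; rewrite mcoeff_msupp [m]mnm3E !mnm3S;
      case: (m 0) => [|i]; rewrite ?Gx ?eqxx //; lia.
  move: mG; rewrite mcoeff_msupp [m]mnm3E.
  case: (m 0) => [|i]; rewrite ?Gx ?eqxx // => _ <-.
  apply/mnmP; apply: ord3P; rewrite !mnmDE !mulmnE !mnm1E mnm0E !mnm3S /=; lia.
pose s := nseq r (var 2%:R : mpoly 3 C) ++ [seq var 1 - t *: var 2%:R | t <- rs].
have -> : mpolyX C mnm0 * (var 2%:R ^+ r * \prod_(t <- rs) (var 1 - t *: var 2%:R)) =
    \prod_(l <- s) l :> mpoly 3 C.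
  by rewrite mpolyX0 mul1r big_cat big_map big_nseq iter_mulr_1.
apply: (@concurrent_scaled_prod (fun i => (i == 0)%:R)).
- by exists 0; rewrite eqxx oner_neq0.
- move=> l; rewrite mem_cat => /orP[/nseqP[-> _]|/mapP[t _ ->]].
    by rewrite mevalXU; split=> //; exact: homog_var.
  rewrite mevalB mevalZ !mevalXU /= mulr0 subr0; split=> //.
  apply: rpredB; last apply: rpredZ; exact: homog_var.
by rewrite size_cat size_nseq size_map rn.
Qed.

End Factorization.

(** * The nilpotent case *)

Lemma not_uniq_perm (T : eqType) (s : seq T) : ~~ uniq s ->
  exists x s', perm_eq s [:: x, x & s'].
Proof.
elim: s => //= x s IH; have [xs _|xs /IH[y [s' E]]] := boolP (x \in s).
  by exists x, (rem x s); rewrite perm_cons perm_to_rem.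
exists y, (x :: s'); rewrite (perm_trans (y := [:: x, y, y & s'])) ?perm_cons //.
by rewrite (perm_catCA [:: x] [:: y; y] s').
Qed.

Section NilpotentCase.
Variable C : numClosedFieldType.
Implicit Types (g p q G : mpoly 3 C) (m : multinom 3) (A : 'M[C]_3).

Lemma linear_derivation_is_linear A : linear (linear_derivation A).
Proof.
move=> c p q; rewrite /linear_derivation scaler_sumr -big_split /=.
by apply: eq_bigr => i _; rewrite mderivD mderivZ mulrDr scalerAr.
Qed.

HB.instance Definition _ A := GRing.isLinear.Build C (mpoly 3 C) (mpoly 3 C) _
  (linear_derivation A) (linear_derivation_is_linear A).

Lemma linear_derivationM A p q : linear_derivation A (p * q) =
  linear_derivation A p * q + p * linear_derivation A q.
Proof.
rewrite /linear_derivation mulr_suml mulr_sumr -big_split /=.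
by apply: eq_bigr => i _; rewrite mderivM; ring.
Qed.

Lemma linear_derivation_var A i : linear_derivation A (var i) = coordinate A i.
Proof.
rewrite /linear_derivation (bigD1 i) //= big1 => [|j ji].
  rewrite mderivX mnm1E eqxx scale1r addr0.
  rewrite (_ : mnm_sub _ _ = mnm0) ?mpolyX0 ?mulr1 //.
  by apply/mnmP => l; rewrite mnmBE mnm0E subnn.
by rewrite mderivX mnm1E eq_sym (negPf ji) scale0r mulr0.
Qed.

Lemma linear_derivation_exp0 A p k :
  linear_derivation A p = 0 -> linear_derivation A (p ^+ k) = 0.
Proof.
move=> dp; elim: k => [|k IH]; last first.
  by rewrite exprS linear_derivationM dp IH mul0r mulr0 addr0.
by rewrite /linear_derivation big1 // => i _; rewrite expr0 -[1]/(mpolyC 3 1) mderivC mulr0.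
Qed.

Let J : 'M[C]_3 := mx3 0 1 0 0 0 1 0 0 0.
Let W : mpoly 3 C := var 1 ^+ 2 - 2%:R * var 0 * var 2%:R.

Lemma jordan3_conic0 : linear_derivation J W = 0.
Proof.
have d0 : linear_derivation J (var 0) = var 1.
  by rewrite linear_derivation_var /coordinate sum3E !mxE /= !scale0r scale1r add0r addr0.
have d1 : linear_derivation J (var 1) = var 2%:R.
  by rewrite linear_derivation_var /coordinate sum3E !mxE /= !scale0r scale1r !add0r.
have d2 : linear_derivation J (var 2%:R) = 0.
  by rewrite linear_derivation_var /coordinate sum3E !mxE /= !scale0r !addr0.
rewrite /W raddfB /= expr2 -mulrA !linear_derivationM d0 d1 d2.
have -> : linear_derivation J 2%:R = 0.
  rewrite /linear_derivation big1 // => i _.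
  by rewrite -[2%:R]/(mpolyC 3 1 *+ 2) mderivMn mderivC mul0rn mulr0.
ring.
Qed.

Lemma hyperosculating_conicE t : hyperosculating_conic 1%:M t = W + t *: var 2%:R ^+ 2.
Proof. by rewrite /hyperosculating_conic !coordinate1. Qed.

Lemma hyperosculating_lin_sub (M N : 'M[C]_3) t :
  lin_sub M (hyperosculating_conic N t) = hyperosculating_conic (N *m M) t.
Proof.
rewrite /hyperosculating_conic rmorphD rmorphB /= linearZ /= !rmorphXn !rmorphM /=.
by rewrite !lin_sub_coordinate rmorph_nat.
Qed.

(** The substitution x = 0, which turns [W] into y^2 and fixes z. *)
Let pr : 'M[C]_3 := mx3 0 0 0 0 1 0 0 0 1.

Lemma mcoeff_restrict_x0 p j k :
  mcoeff (mnm3 0 j k) (lin_sub pr p) = mcoeff (mnm3 0 j k) p.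
Proof.
elim/mpolyind: p => [|c m p _ _ IH]; first by rewrite raddf0.
rewrite raddfD /= !mcoeffD IH linearZ /= !mcoeffZ; congr (_ * _ + _).
have px i : lin_sub pr (var i) = (i != 0)%:R *: var i.
  rewrite lin_sub_var /coordinate sum3E !mxE; elim/ord3P: i;
  by rewrite /= ?scale0r ?scale1r ?add0r ?addr0.
rewrite [m]mnm3E; case: (m 0) => [|i].
  congr mcoeff; rewrite mpolyXE_id rmorph_prod; apply: eq_bigr => i _.
  rewrite rmorphXn /= px; elim/ord3P: i; last by rewrite scale1r.
    by rewrite mnm3S !expr0.
  by rewrite scale1r.
rewrite mpolyXE_id rmorph_prod (bigD1 0) //= rmorphXn /= px mnm3S scale0r.
rewrite expr0n mul0r mcoeff0 -mpolyXE_id mcoeffX; case: eqP => // E.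
Qed.

Let pW : lin_sub pr W = var 1 ^+ 2.
Proof.
  rewrite rmorphB rmorphXn !rmorphM /= !lin_sub_var /coordinate !sum3E !mxE /=.
  by rewrite !scale0r !scale1r !addr0 add0r mulr0 mul0r subr0.
Qed.

Let p2 : lin_sub pr (var 2%:R) = var 2%:R.
Proof.
  by rewrite !lin_sub_var /coordinate !sum3E !mxE /= !scale0r scale1r !add0r.
Qed.

(** The right side lies in the kernel, and at x = 0 its terms become monomials y^(2s) z^(n-2s) with
    the coefficients of G. Uniqueness of a kernel element with given restriction concludes. *)
Lemma jordan3_kernel n G : poly_homogeneous n G -> linear_derivation J G = 0 ->
  G = var 2%:R ^+ odd n * \sum_(s < n./2.+1) mcoeff (mnm3 0 s.*2 (n - s.*2)) G *:
    (W ^+ s * (var 2%:R ^+ 2) ^+ (n./2 - s)).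
Proof.
move=> hG dG; set H := RHS; apply/eqP; rewrite -subr_eq0; apply/eqP.
have d2 : linear_derivation J (var 2%:R) = 0.
  by rewrite linear_derivation_var /coordinate sum3E !mxE /= !scale0r !addr0.
have dH : linear_derivation J H = 0.
  rewrite /H linear_derivationM linear_derivation_exp0 // mul0r add0r raddf_sum.
  rewrite big1 ?mulr0 // => s _; rewrite /= linearZ /= linear_derivationM.
  by rewrite !linear_derivation_exp0 ?mul0r ?mulr0 ?addr0 ?scaler0 //; exact: jordan3_conic0.
apply: jordan3_kernel_unique => [|j k]; first by rewrite raddfB /= dG dH subr0.
rewrite mcoeffB; have -> : mcoeff (mnm3 0 j.*2 k) H = \sum_(s < n./2.+1)
    mcoeff (mnm3 0 s.*2 (n - s.*2)) G * (mnm3 0 s.*2 (n - s.*2) == mnm3 0 j.*2 k)%:R.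
  rewrite -mcoeff_restrict_x0 rmorphM rmorphXn /= p2 raddf_sum mulr_sumr raddf_sum.
  apply: eq_bigr => s _; rewrite /= linearZ /= rmorphM !rmorphXn /= pW p2.
  rewrite -scalerAr mcoeffZ; congr (_ * _).
  rewrite !mpolyXn -!mpolyXD mcoeffX; congr (_ == _)%:R.
  apply/mnmP; apply: ord3P; rewrite !mnmDE !mulmnE !mnm1E !mnm3S /=;
    move: (ltn_ord s) (odd_double_half n); lia.
have [jk|jk] := eqVneq (j.*2 + k)%N n; last first.
  rewrite (homog_coeff hG) // big1 ?subr0 // => s _.
  case: eqP => [E|]; last by rewrite mulr0.
  have := congr1 (fun m : multinom 3 => m 1) E.
  have := congr1 (fun m : multinom 3 => m 2%:R) E.
  by rewrite !mnm3S => ? ?; have := ltn_ord s; move: jk; lia.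
have jn : (j < n./2.+1)%N by lia.
rewrite (bigD1 (Ordinal jn)) //= big1 => [|s].
  by rewrite (_ : n - j.*2 = k)%N ?eqxx ?mulr1 ?addr0 ?subrr //; lia.
rewrite -val_eqE /= => sj; case: eqP => [E|]; last by rewrite mulr0.
by have := congr1 (fun m : multinom 3 => m 1) E; rewrite !mnm3S; lia.
Qed.

(** The kernel formula is a binary form in [W] and z^2, up to a factor z for odd n. Splitting it
    gives conics of the pencil, and reducedness excludes z^2 and repeated conics. *)
Lemma jordan3_ploski n G : (0 < n)%N -> poly_homogeneous n G -> G != 0 ->
  reduced_curve G -> linear_derivation J G = 0 ->
  concurrent_lines G \/ exists (s : seq C) (c : C), [/\ (0 < size s)%N, uniq s, c != 0 &
    G = c *: (var 2%:R ^+ odd n * \prod_(t <- s) hyperosculating_conic 1%:M t)].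
Proof.
move=> n0 hG G0 redG dG.
pose P := \poly_(s < n./2.+1) mcoeff (mnm3 0 s.*2 (n - s.*2)) G.
have GE : G = var 2%:R ^+ odd n * \sum_(s < n./2.+1) P`_s *:
    (W ^+ s * (var 2%:R ^+ 2) ^+ (n./2 - s)).
  rewrite [LHS](jordan3_kernel hG dG); congr (_ * _); apply: eq_bigr => s _.
  by rewrite coef_poly ltn_ord.
have P0 : P != 0.
  apply: contraNneq G0 => P0; rewrite GE P0 big1 ?mulr0 // => s _.
  by rewrite coef0 scale0r.
have [c [r [rs [c0 rQ E]]]] := binary_form_split W (var 2%:R ^+ 2) P0 (size_poly _ _).
rewrite E -scalerAr mulrCA in GE.
have nconst (h : mpoly 3 C) m : m != mnm0 -> mcoeff m h != 0 ->
    forall q, G = q * h ^+ 2 -> False.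
  move=> m0 hm q /redG[a ha]; move: hm.
  by rewrite ha mcoeffC (negPf m0) mulr0 eqxx.
have r0 : r = 0%N.
  case: r rQ GE {E} => // r rQ GE; exfalso.
  pose q := c *: ((var 2%:R ^+ 2) ^+ r * (var 2%:R ^+ odd n *
                  \prod_(t <- rs) (W - t *: var 2%:R ^+ 2))).
  apply: (nconst (var 2%:R) (mnm1 2%:R) _ _ q).
  - by rewrite mnm1_eq0.
  - by rewrite mcoeffX eqxx oner_eq0.
  by rewrite GE exprS -mulrA [RHS]mulrC -scalerAr.
subst r; rewrite expr0 mul1r in GE; rewrite add0n in rQ.
(* A repeated root gives a squared conic; it is nonconstant because its y^2 coefficient, read at x =
   0, is 1. *)
have rs_uniq : uniq rs.
  apply: contraPT (I) => /not_uniq_perm[t [rs' prs]] _.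
  pose q := c *: (var 2%:R ^+ odd n * \prod_(t <- rs') (W - t *: var 2%:R ^+ 2)).
  apply: (nconst (W - t *: var 2%:R ^+ 2) (mnm3 0 2 0) _ _ q).
  - by apply/eqP => E'; have := congr1 (fun m : multinom 3 => m 1) E';
      rewrite mnm3S mnm0E.
  - rewrite -mcoeff_restrict_x0 raddfB /= linearZ /= rmorphXn /= pW p2 !mpolyXn.
    rewrite mcoeffB mcoeffZ !mcoeffX (_ : mnm_muln (mnm1 1) 2 = mnm3 0 2 0) ?eqxx;
      last first.
      by apply/mnmP; apply: ord3P; rewrite mulmnE mnm1E.
    suff /negPf -> : mnm_muln (mnm1 2%:R) 2 != mnm3 0 2 0 by rewrite mulr0 subr0 oner_eq0.
    by apply/eqP => /(congr1 (fun m : multinom 3 => m 1)); rewrite mulmnE mnm1E mnm3S.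
  rewrite GE (perm_big _ prs) !big_cons /= -scalerAl expr2; congr (_ *: _); ring.
case: (posnP (size rs)) => [rs0|rs0]; [left|right].
  (* No conic is left: n = 1 and [G] is a multiple of the single line z = 0. *)
  have n1 : odd n = true by move: n0 rQ; rewrite rs0 => + /esym; lia.
  have -> : G = c *: \prod_(l <- [:: var 2%:R : mpoly 3 C]) l.
    by rewrite GE (size0nil rs0) n1 expr1 big_nil mulr1 big_seq1.
  apply: (@concurrent_scaled_prod _ (fun i => (i == 0)%:R)) => //.
    by exists 0; rewrite eqxx oner_neq0.
  by move=> l; rewrite mem_seq1 => /eqP ->; rewrite mevalXU; split=> //; exact: homog_var.
(* The factors are W - t z^2, whereas the conics of the pencil are parametrized with a plus sign. *)
exists (map -%R rs), c; split=> //; first by rewrite size_map.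
  by rewrite (map_inj_uniq oppr_inj).
rewrite GE big_map; congr (_ *: (_ * _)); apply: eq_bigr => t _.
by rewrite hyperosculating_conicE scaleNr.
Qed.

End NilpotentCase.

(** * The diagonalizable case *)

Section LocalForm.
Variable C : numClosedFieldType.
Implicit Types (g G : mpoly 3 C) (p q : 'I_3 -> C) (m : multinom 3).

Definition chart_point q (k : 'I_3) (y : 'I_2 -> C) : 'I_3 -> C :=
  fun j => if unlift k j is Some a then y a + q j / q k else 1.

(** An algebraic certificate of quasi-homogeneity: in the affine chart centred at q the equation is
    a unit [v] times a weighted homogeneous [h], with no further change of variables. *)
Definition local_form G q : Prop :=
  exists (k : 'I_3) (v h : mpoly 2 C),
    [/\ q k != 0, weighted_homogeneous h, meval (fun=> 0) v != 0 &
      forall y, meval (chart_point q k y) G = meval y v * meval y h].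

Lemma meval_chart_point G q k y : meval (chart_point q k y) G =
  \sum_(m <- msupp G) mcoeff m G *
     \prod_(a < 2) (y a + q (lift k a) / q k) ^+ m (lift k a).
Proof.
rewrite mevalE; apply: eq_bigr => m _; congr (_ * _).
rewrite (bigD1_ord k) //= /chart_point unlift_none expr1n mul1r.
by apply: eq_bigr => a _; rewrite liftK.
Qed.

Lemma weighted_homogeneousX n (m : multinom n) : weighted_homogeneous (mpolyX C m).
Proof.
exists (fun=> 1), (mdeg m)%:R; split=> // e; rewrite msuppX mem_seq1 => /eqP ->.
by rewrite mdegE natr_sum; apply: eq_bigr => i _; rewrite mulr1.
Qed.

Lemma seq_argmin (T : eqType) (s : seq T) (f : T -> nat) x0 : x0 \in s ->
  exists2 x, x \in s & forall y, y \in s -> (f x <= f y)%N.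
Proof.
elim: s x0 => // x s IH x0 _; case: s IH => [|z s] IH.
  by exists x => [|y]; rewrite mem_seq1 // => /eqP ->.
have [w ws hw] := IH z (mem_head _ _).
have [fxw|/ltnW fwx] := leqP (f x) (f w).
  exists x => [|y]; first exact: mem_head.
  by rewrite in_cons => /orP[/eqP->//|/hw]; exact: leq_trans.
exists w => [|y]; first by rewrite in_cons ws orbT.
by rewrite in_cons => /orP[/eqP->//|/hw].
Qed.

(* At a coordinate point the exponents of the local equation lie on a line: if it
   has negative slope the equation is weighted homogeneous, otherwise it is the
   product of a monomial and a unit. *)
Lemma local_form_coordinate_point n G q k : poly_homogeneous n G -> G != 0 ->
  q k != 0 -> (forall a, q (lift k a) = 0) ->
  (forall m1 m2 m3 i j, m1 \in msupp G -> m2 \in msupp G -> m3 \in msupp G ->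
     ((m2 i)%:Z - (m1 i)%:Z) * ((m3 j)%:Z - (m1 j)%:Z) =
     ((m2 j)%:Z - (m1 j)%:Z) * ((m3 i)%:Z - (m1 i)%:Z)) ->
  local_form G q.
Proof.
move=> hG G0 qk q0 line.
pose rho m : multinom 2 := Multinom [tuple m (lift k a) | a < 2].
have rhoE m a : rho m a = m (lift k a) by rewrite mnm_tnth tnth_mktuple.
have GE y : meval (chart_point q k y) G =
    \sum_(m <- msupp G) mcoeff m G * \prod_a y a ^+ m (lift k a).
  rewrite meval_chart_point; apply: eq_bigr => m _; congr (_ * _).
  by apply: eq_bigr => a _; rewrite q0 mul0r addr0.
(* [m0] is an exponent of least degree in the two affine coordinates. *)
have [m0 m0G hm0] := @seq_argmin _ (msupp G) (fun m => mdeg (rho m)) _ (mlead_supp G0).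
have rho_inj m m' : m \in msupp G -> m' \in msupp G -> rho m = rho m' -> m = m'.
  move=> /(dhomog_mf hG) /= dm /(dhomog_mf hG) /= dm' E.
  have Ea a : m (lift k a) = m' (lift k a) by rewrite -!rhoE E.
  apply/mnmP => l; case: (unliftP k l) => [a|] ->; first exact: Ea.
  move: dm dm'; rewrite !mdegE !(bigD1_ord k) //= => <-.
  by under eq_bigr do rewrite -Ea; move=> /addIn ->.
have G0m m : m \in msupp G -> mcoeff m G != 0 by rewrite -mcoeff_msupp.
(* If all exponents dominate [m0], its monomial factors out, and the cofactor is a unit since only
   [m0] contributes to its constant term. *)
have [chain|] := boolP (all (fun m => lem (rho m0) (rho m)) (msupp G)).
  exists k, (\sum_(m <- msupp G) mcoeff m G *: mpolyX C (mnm_sub (rho m) (rho m0))),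
    (mpolyX C (rho m0)); split=> //; first exact: weighted_homogeneousX.
    rewrite raddf_sum /= (bigD1_seq m0) //= big_seq_cond big1 => [|m /andP[mG mm0]].
      rewrite addr0 mevalZ mevalX big1 ?mulr1 ?G0m // => a _.
      by rewrite mnmBE subnn expr0.
    rewrite mevalZ mevalX; have /allP/(_ m mG)/mnm_lepP le := chain.
    have [a am] : exists a, rho m a != rho m0 a.
      apply/existsP; apply: contraNT mm0 => /existsPn h; apply/eqP/rho_inj => //.
      by apply/mnmP => a; apply/eqP; rewrite -[_ == _]negbK.
    rewrite (bigD1 a) //= mnmBE expr0n.
    by rewrite subn_eq0 leqNgt ltn_neqAle eq_sym am le !mul0r mulr0.
  move=> y; rewrite GE raddf_sum mulr_suml; apply: eq_big_seq => m mG /=.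
  rewrite mevalZ !mevalX -mulrA -big_split /=; congr (_ * _).
  apply: eq_bigr => a _; rewrite -exprD mnmBE subnK ?rhoE //.
  by have /allP/(_ m mG)/mnm_lepP/(_ a) := chain; rewrite !rhoE.
(* Otherwise [m1] has one affine exponent below that of [m0] and, its degree being no smaller, the
   other above: the line has negative slope. *)
move=> /allPn[m1 m1G /mnm_lepP lt].
exists k, 1, (\sum_(m <- msupp G) mcoeff m G *: mpolyX C (rho m)); split=> //; last first.
- move=> y; rewrite GE meval1 mul1r raddf_sum; apply: eq_bigr => m _ /=.
  by rewrite mevalZ mevalX; congr (_ * _); apply: eq_bigr => a _; rewrite rhoE.
- by rewrite meval1 oner_eq0.
pose i0 : 'I_3 := lift k (0 : 'I_2); pose i1 : 'I_3 := lift k (1 : 'I_2).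
have E2 m : mdeg (rho m) = (m i0 + m i1)%N.
  rewrite mdegE !big_ord_recl big_ord0 addn0 !rhoE.
  by congr (_ + m (lift k _))%N; exact: val_inj.
have supp_rho e : e \in msupp (\sum_(m <- msupp G) mcoeff m G *: mpolyX C (rho m)) ->
    exists2 m, m \in msupp G & e = rho m.
  rewrite mcoeff_msupp raddf_sum /= => h.
  have /hasP[m mG /eqP me] : has (fun m => e == rho m) (msupp G).
    apply: contraNT h => /hasPn h; rewrite big_seq big1 // => m mG.
    by rewrite mcoeffZ mcoeffX eq_sym (negPf (h m mG)) mulr0.
  by exists m.
have := hm0 m1 m1G; rewrite !E2 => dm.
(* Swapping the absolute differences gives a normal vector of this line with positive entries. *)
pose w (a : 'I_2) : rat :=
  `|(m1 (lift k (rev_ord a)))%:Z - (m0 (lift k (rev_ord a)))%:Z|%:~R.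
have E01 : (m1 i0 < m0 i0)%N /\ (m0 i1 < m1 i1)%N \/
           (m1 i1 < m0 i1)%N /\ (m0 i0 < m1 i0)%N.
  have [l0|l0] := ltnP (m1 i0) (m0 i0); first by left; lia.
  have [l1|l1] := ltnP (m1 i1) (m0 i1); first by right; lia.
  by case: lt => -[[|[|//]] h]; rewrite !rhoE;
    [rewrite (_ : Ordinal h = 0)|rewrite (_ : Ordinal h = 1)] => //; exact: val_inj.
have w0 : w 0 = `|(m1 i1)%:Z - (m0 i1)%:Z|%:~R.
  by rewrite /w (_ : rev_ord 0 = 1) //; exact: val_inj.
have w1 : w 1 = `|(m1 i0)%:Z - (m0 i0)%:Z|%:~R.
  by rewrite /w (_ : rev_ord 1 = 0) //; exact: val_inj.
have sum2 (f : 'I_2 -> rat) : \sum_a f a = f 0 + f 1.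
  by rewrite !big_ord_recl big_ord0 addr0; congr (_ + f _); exact: val_inj.
exists w, (\sum_a (rho m0 a)%:R * w a); split.
  case=> -[|[|//]] h; [rewrite (_ : Ordinal h = 0) ?w0|rewrite (_ : Ordinal h = 1) ?w1];
  try exact: val_inj; rewrite ltr0z; move: E01; lia.
move=> e /supp_rho[m mG ->]; rewrite !sum2 w0 w1 !rhoE.
have := line m0 m1 m i0 i1 m0G m1G mG.
rewrite !pmulrn -!intrM -!intrD => E; congr (_%:~R).
move/eqP: E; rewrite -subr_eq0 => /eqP E.
apply/eqP; rewrite -subr_eq0; apply/eqP.
case: E01 => [[l0 l1]|[l1 l0]]; [rewrite -oppr0 -E|rewrite -E].
  rewrite [`|_|]gtr0_norm ?[`|_|]ltr0_norm; [ring|lia|lia].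
rewrite [`|_|]ltr0_norm ?[`|_|]gtr0_norm; [ring|lia|lia].
Qed.

End LocalForm.

(** * Local forms when an exponent is constant, or on one coordinate line *)

Section ChartComputations.
Variable C : numClosedFieldType.
Implicit Types (g G : mpoly 3 C) (p q : 'I_3 -> C) (m : multinom 3).

Lemma ord2_cases (a c : 'I_2) : c = a \/ c = rev_ord a.
Proof.
by case: a c => -[|[|//]] ? [[|[|//]] ?];
  [left|right|right|left]; exact: val_inj.
Qed.

Lemma big_ord2 (T : Type) (idx : T) (op : Monoid.com_law idx) (f : 'I_2 -> T) a :
  \big[op/idx]_c f c = op (f a) (f (rev_ord a)).
Proof.
rewrite (bigD1 a) //=; congr (op _ _); apply: big_pred1 => c /=.
by case: a c => -[|[|//]] ? [[|[|//]] ?].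
Qed.

(** Such a form is the e-th power of the i-th variable times a binary form in the two others, so in
    the chart it is a product of functions of one coordinate each. *)
Lemma local_form_binary n e i k G q : poly_homogeneous n G -> G != 0 ->
  (forall m, m \in msupp G -> m i = e) -> k != i -> q k != 0 -> local_form G q.
Proof.
move=> hG G0 Ge ki qk; have [a ia _] := unlift_some ki.
pose b := rev_ord a; pose j := lift k b.
have ij : i != j by rewrite ia /j (inj_eq lift_inj) /b; case: (a) => -[|[|//]].
have kj : k != j by exact: neq_lift.
have md m : mdeg m = (m k + (m i + m j))%N.
  by rewrite mdegE (bigD1_ord k) //= (big_ord2 _ _ a) /= ia.
have degm m : m \in msupp G -> (m k + (e + m j))%N = n.
  by move=> mG; rewrite -(dhomog_mf hG mG) /= md Ge.
have [||c [r [rs [c0 _ GE]]]] :=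
  @binomial_factorization _ G (mnm_muln (mnm1 i) e) (mnm1 j) (mnm1 k) (n - e) G0.
- by rewrite eq_mnm1 eq_sym.
- move=> m mG; exists (m j); first by have := degm m mG; lia.
  apply/mnmP => l; rewrite !mnmDE !mulmnE !mnm1E.
  have := degm m mG; have := Ge m mG.
  case: (unliftP k l) => [c|] ->; last first.
    by rewrite eqxx eq_sym (negPf ki) eq_sym (negPf kj); lia.
  have [->|->] : c = a \/ c = b by exact: ord2_cases.
    by rewrite -ia eqxx (negPf ki) eq_sym (negPf ij); lia.
  by rewrite -/j eqxx (negPf kj) (negPf ij); lia.
(* [ta] and [tb] are the affine coordinates of [q]. Factors that do not vanish at [q] go to the unit
   [v]; the others form the monomial [h]. *)
pose ta := q i / q k; pose tb := q j / q k.
pose v0 : mpoly 2 C := if ta == 0 then 1 else (var a + mpolyC 2 ta) ^+ e.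
pose v := c *: (v0 * \prod_(t <- rs | t != tb) (var b + mpolyC 2 (tb - t))).
pose h0 : multinom 2 := if ta == 0 then mnm_muln (mnm1 a) e else mnm0.
pose h : mpoly 2 C := mpolyX C (mnm_add h0 (mnm_muln (mnm1 b) (count (pred1 tb) rs))).
exists k, v, h; split=> //; first exact: weighted_homogeneousX.
  rewrite mevalZ mevalM mulf_neq0 //= ?mulf_neq0 //.
    rewrite /v0; case: (ta =P 0) => [_|/eqP ta0]; first by rewrite meval1 oner_eq0.
    by rewrite rmorphXn /= mevalD mevalXU mevalC add0r expf_neq0.
  rewrite rmorph_prod prodf_seq_neq0; apply/allP => t _; apply/implyP => ttb.
  by rewrite /= mevalD mevalXU mevalC add0r subr_eq0 eq_sym.
move=> y; rewrite GE.
have pk : chart_point q k y k = 1 by rewrite /chart_point unlift_none.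
have pi : chart_point q k y i = y a + ta by rewrite /ta [in LHS]ia /chart_point liftK -ia.
have pj : chart_point q k y j = y b + tb by rewrite /chart_point liftK.
rewrite mevalZ !mevalM -!mpolyXn !rmorphXn /= !mevalXU pk pi expr1n mul1r.
rewrite rmorph_prod /=.
under eq_bigr do rewrite mevalB mevalZ !mevalXU pk pj mulr1 -addrA.
rewrite (bigID (pred1 tb)) /=.
rewrite (eq_bigr (fun=> y b)) => [|t /eqP ->]; last by rewrite subrr addr0.
rewrite big_const_seq iter_mulr_1 /v mevalZ mevalM -!mulrA; congr (_ * _).
rewrite rmorph_prod /=.
under [in RHS]eq_bigr do rewrite mevalD mevalXU mevalC.
rewrite /h mpolyXD mevalM -mpolyXn rmorphXn /= mevalXU [RHS]mulrCA.
have <- : meval y v0 * meval y (mpolyX C h0) = (y a + ta) ^+ e.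
  rewrite /v0 /h0; case: (ta =P 0) => [->|_].
    by rewrite meval1 mul1r addr0 -mpolyXn rmorphXn /= mevalXU.
  by rewrite mpolyX0 meval1 mulr1 rmorphXn /= mevalD mevalXU mevalC.
by rewrite !mulrA mulrC !mulrA.
Qed.

(** Near q only the i-th coordinate vanishes. After its lowest power is factored out, injectivity
    leaves one term of the cofactor at q, which is nonzero: the cofactor is a unit. *)
Lemma local_form_transverse i G q : G != 0 ->
  {in msupp G &, injective (fun m => m i)} ->
  q i = 0 -> (forall l, l != i -> q l != 0) -> local_form G q.
Proof.
move=> G0 inj qi q0; pose k := lift i (0 : 'I_2).
have ki : k != i by rewrite eq_sym neq_lift.
have qk := q0 k ki; have [a ia _] := unlift_some ki.
pose b := rev_ord a; pose j := lift k b.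
have ij : j != i by rewrite ia /j (inj_eq lift_inj) /b; case: (a) => -[|[|//]].
have [m0 m0G min] := @seq_argmin _ (msupp G) (fun m => m i) _ (mlead_supp G0).
have tb0 : q j / q k != 0 by rewrite mulf_neq0 ?invr_eq0 // q0.
pose vm m : mpoly 2 C := var a ^+ (m i - m0 i) * (var b + mpolyC 2 (q j / q k)) ^+ m j.
exists k, (\sum_(m <- msupp G) mcoeff m G *: vm m), (mpolyX C (mnm_muln (mnm1 a) (m0 i))).
have vmE y m : meval y (vm m) = y a ^+ (m i - m0 i) * (y b + q j / q k) ^+ m j.
  by rewrite mevalM !rmorphXn /= mevalD !mevalXU mevalC.
split=> //; first exact: weighted_homogeneousX.
  rewrite raddf_sum /= (bigD1_seq m0) //= big_seq_cond big1 => [|m /andP[mG mm0]].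
    rewrite addr0 mevalZ vmE subnn expr0 mul1r add0r mulf_neq0 ?expf_neq0 //.
    by rewrite -mcoeff_msupp.
  rewrite mevalZ vmE expr0n subn_eq0 leqNgt ltn_neqAle min // andbT eq_sym.
  rewrite (_ : m i != m0 i) ?mul0r ?mulr0 //; apply: contra_neq mm0; exact: inj.
move=> y; rewrite meval_chart_point raddf_sum mulr_suml; apply: eq_big_seq => m mG.
rewrite /= mevalZ vmE -mulrA; congr (_ * _).
rewrite (big_ord2 _ _ a) /= -/b -/j -ia qi mul0r addr0.
rewrite -mpolyXn rmorphXn /= mevalXU mulrAC -exprD subnK //; exact: min.
Qed.

End ChartComputations.

(** * The lattice of exponent differences *)

Section Lattice.
Variables (C : numClosedFieldType) (w : 'I_3 -> C).
Implicit Types (d : 'I_3 -> int).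

(** The integer vectors orthogonal to (1, 1, 1) and to w: differences of exponents of equal degree
    and equal weight. *)
Definition weight_lattice d : Prop :=
  \sum_i d i = 0 /\ \sum_i w i * (d i)%:~R = 0.

Lemma weight_latticeB d d' q : weight_lattice d -> weight_lattice d' ->
  weight_lattice (fun i => d i - q * d' i).
Proof.
move=> [d1 d2] [d1' d2']; split; first by rewrite sumrB -mulr_sumr d1 d1' mulr0 subr0.
under eq_bigr do rewrite rmorphB rmorphM /= mulrBr mulrCA.
by rewrite sumrB -mulr_sumr d2 d2' mulr0 subr0.
Qed.

Hypothesis w_nconst : exists i, w i != w 0.

(** Since w is not a multiple of (1, 1, 1), the two linear conditions are independent and leave a
    line, so all 2 x 2 minors vanish. *)
Lemma weight_lattice_rank1 d d' i j : weight_lattice d -> weight_lattice d' ->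
  d i * d' j = d j * d' i.
Proof.
rewrite /weight_lattice !sum3E => -[d1 d2] [d1' d2'].
have E1 : (w 1 - w 0) * (d 1)%:~R + (w 2%:R - w 0) * (d 2%:R)%:~R = 0 :> C.
  have E : d 0 = - d 1 - d 2%:R by lia.
  by rewrite -[RHS]d2 E rmorphB rmorphN /=; ring.
have E2 : (w 1 - w 0) * (d' 1)%:~R + (w 2%:R - w 0) * (d' 2%:R)%:~R = 0 :> C.
  have E : d' 0 = - d' 1 - d' 2%:R by lia.
  by rewrite -[RHS]d2' E rmorphB rmorphN /=; ring.
(* Elimination kills the minor times [w 1 - w 0] and times [w 2 - w 0]; one of these differences is
   nonzero. *)
have E12 : d 1 * d' 2%:R = d 2%:R * d' 1.
  have F1 : (w 1 - w 0) * ((d 1 * d' 2%:R)%:~R - (d 2%:R * d' 1)%:~R) = 0 :> C.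
    transitivity ((d' 2%:R)%:~R * ((w 1 - w 0) * (d 1)%:~R + (w 2%:R - w 0) * (d 2%:R)%:~R)
      - (d 2%:R)%:~R * ((w 1 - w 0) * (d' 1)%:~R + (w 2%:R - w 0) * (d' 2%:R)%:~R)).
      by rewrite !rmorphM /=; ring.
    by rewrite E1 E2 !mulr0 subr0.
  have F2 : (w 2%:R - w 0) * ((d 1 * d' 2%:R)%:~R - (d 2%:R * d' 1)%:~R) = 0 :> C.
    transitivity ((d 1)%:~R * ((w 1 - w 0) * (d' 1)%:~R + (w 2%:R - w 0) * (d' 2%:R)%:~R)
      - (d' 1)%:~R * ((w 1 - w 0) * (d 1)%:~R + (w 2%:R - w 0) * (d 2%:R)%:~R)).
      by rewrite !rmorphM /=; ring.
    by rewrite E1 E2 !mulr0 subr0.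
  apply/eqP; rewrite -(eqr_int C) -subr_eq0; have [k wk] := w_nconst.
  elim/ord3P: k wk => wk; first by rewrite eqxx in wk.
    by apply/eqP; move: wk; rewrite -subr_eq0 => /mulfI; apply; rewrite F1 mulr0.
  by apply/eqP; move: wk; rewrite -subr_eq0 => /mulfI; apply; rewrite F2 mulr0.
move: i j; apply: ord3P; apply: ord3P; nia.
Qed.

(** Euclidean descent: if [d 0] fails to divide some [d' 0], the remainder is the zeroth entry of a
    lattice vector, positive and smaller. *)
Lemma weight_lattice_generator d : weight_lattice d -> d 0 != 0 ->
  exists2 d1, weight_lattice d1 & 0 < d1 0 /\
    forall d', weight_lattice d' -> (d1 0%R %| d' 0%R)%Z.
Proof.
move=> Ld d0; wlog {d0} dpos : d Ld / 0 < d 0.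
  move=> IH; have [dpos|] := ltP 0 (d 0); first exact: IH dpos.
  rewrite le_eqVlt (negPf d0) /= => dneg.
  (* The opposite vector, written so that closure under [d - q * d'] applies. *)
  apply: (IH (fun i => d i - 2 * d i)); last by lia.
  exact: weight_latticeB.
have [s] := ubnP `|d 0%R|%N; elim: s d Ld dpos => // s IH d Ld dpos ds.
have [h|] := EM (forall d', weight_lattice d' -> (d 0%R %| d' 0%R)%Z); first by exists d.
move=> /existsNP[d' /not_implyP[Ld' dd']].
have r0 : (d' 0%R %% d 0%R)%Z != 0 by apply: contra_notN dd' => /eqP/dvdz_mod0P.
have rpos : 0 <= (d' 0%R %% d 0%R)%Z by rewrite modz_ge0 // gt_eqF.
have rlt : (d' 0%R %% d 0%R)%Z < d 0 by rewrite ltz_pmod.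
have rE : d' 0 - (d' 0%R %/ d 0%R)%Z * d 0 = (d' 0%R %% d 0%R)%Z by [].
apply: (IH (fun i => d' i - (d' 0%R %/ d 0%R)%Z * d i)); rewrite ?rE; [|lia|lia].
exact: weight_latticeB.
Qed.
End Lattice.

(** * Singularities of a form killed by a diagonal field *)

Section DiagonalCase.
Variable C : numClosedFieldType.
Implicit Types (g G : mpoly 3 C) (p q : 'I_3 -> C) (m : multinom 3).

(** The form is a monomial times factors U - tV in two monomials. Monomials do not vanish at q, and
    each factor through q has nonzero derivative there, so a singularity forces the factor with t =
    U(q)/V(q) to occur twice. *)
Lemma torus_not_singular n (w : 'I_3 -> C) G q :
  poly_homogeneous n G -> (exists i, w i != w 0) ->
  (forall m m', m \in msupp G -> m' \in msupp G ->
     weight_lattice w (fun i => (m' i)%:Z - (m i)%:Z)) ->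
  (exists m m', [/\ m \in msupp G, m' \in msupp G & m 0 != m' 0]) ->
  reduced_curve G -> (forall i, q i != 0) -> ~ singular_point G q.
Proof.
move=> hG wn supp [ma [mb [maG mbG mab]]] redG q0 [_ Gq dGq].
have [|d Ld [dpos ddiv]] := weight_lattice_generator (supp _ _ maG mbG).
  by move: mab; lia.
have [m0 m0G min] := @seq_argmin _ (msupp G) (fun m => m 0) _ maG.
(* By divisibility and rank one every exponent is [m0 + s d], with [s] nonnegative by minimality of
   [m0]. *)
have mE m : m \in msupp G -> exists s : nat, forall i, (m i)%:Z = (m0 i)%:Z + s%:Z * d i.
  move=> mG; have Lm := supp _ _ m0G mG.
  have /dvdzP[s sE] := ddiv _ Lm.
  have s0 : 0 <= s by have := min m mG; nia.
  exists `|s|%N => i; rewrite gez0_abs //.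
  have := weight_lattice_rank1 wn 0 i (weight_latticeB s Lm Ld) Ld.
  by rewrite sE subrr mul0r => /esym/eqP; rewrite mulf_eq0 (gt_eqF dpos) orbF; lia.
have [m2 m2G max] : exists2 m, m \in msupp G &
    forall m', m' \in msupp G -> (m' 0%R <= m 0%R)%N.
  have [m mG h] := @seq_argmin _ (msupp G) (fun m => n - m 0%R)%N _ maG.
  exists m => // m' m'G; have := h m' m'G.
  by rewrite leq_sub2lE // -(dhomog_mf hG m'G) /= mdegE (bigD1 0) //= leq_addr.
have [Q QE] := mE m2 m2G.
pose dp : multinom 3 := Multinom [tuple (if d i is Posz k then k else 0) | i < 3].
pose dn : multinom 3 := Multinom [tuple (if d i is Negz k then k.+1 else 0) | i < 3].
have dpE i : dp i = if d i is Posz k then k else 0%N by rewrite mnm_tnth tnth_mktuple.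
have dnE i : dn i = if d i is Negz k then k.+1 else 0%N by rewrite mnm_tnth tnth_mktuple.
(* No truncation occurs: [m2 = m0 + Q d] is nonnegative, so [m0] is at least [Q] times the negative
   part of [d]. *)
pose e := mnm_sub m0 (mnm_muln dn Q).
have dp0 : (0 < dp 0%R)%N by rewrite dpE; case: (d 0) dpos.
have dn0 : dn 0 = 0%N by rewrite dnE; case: (d 0) dpos.
have G0 : G != 0 by apply: contraTneq maG => ->; rewrite msupp0.
have [||c [r [rs [c0 _ GE]]]] := @binomial_factorization _ G e dp dn Q G0.
- by apply: contraTneq dp0 => ->; rewrite dn0.
- move=> m mG; have [s sE] := mE m mG; exists s.
    by have := max m mG; have := sE 0; have := QE 0; nia.
  have sQ : (s <= Q)%N by have := max m mG; have := sE 0; have := QE 0; nia.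
  apply/mnmP => i; rewrite !mnmDE mnmBE !mulmnE dpE dnE.
  by have := sE i; have := QE i; case: (d i) => k; nia.
pose U := mpolyX C dp; pose V := mpolyX C dn.
have mq (m : multinom 3) : meval q (mpolyX C m) != 0.
  by rewrite mevalX; apply/prodf_neq0 => i _; rewrite expf_neq0.
have root rs' : meval q (\prod_(t <- rs') (U - t *: V)) = 0 ->
    exists2 t, t \in rs' & t = meval q U / meval q V.
  rewrite rmorph_prod => /eqP; rewrite prodf_seq_eq0 => /hasP[t trs /=].
  rewrite mevalB mevalZ subr_eq0 => /eqP E; exists t => //.
  by rewrite E mulfK // mq.
set t := _ / _ in root.
have trs : t \in rs.
  have [|t' t'rs <- //] := root rs.
  move/eqP: Gq; rewrite GE mevalZ !mevalM rmorphXn /= -/U -/V.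
  by rewrite !mulf_eq0 (negPf c0) expf_eq0 !(negPf (mq _)) andbF => /eqP.
pose F := U - t *: V; pose rs' := rem t rs.
pose H := c *: (mpolyX C e * (V ^+ r * \prod_(t <- rs') (U - t *: V))).
have GFH : G = F * H.
  rewrite GE (perm_big _ (perm_to_rem trs)) big_cons /H /= -/F -scalerAr.
  by congr (_ *: _); ring.
have Fq : meval q F = 0.
  by rewrite mevalB mevalZ /t divfK ?subrr //; exact: mq.
(* The zeroth variable occurs in [U] and not in [V], as [d 0] is positive. *)
have dFq : meval q (mderiv 0 F) != 0.
  rewrite mderivB mderivZ !mderivX dn0 scale0r scaler0 subr0 mevalZ mulf_neq0 //.
  by rewrite pnatr_eq0 -lt0n.
have Hq : meval q H = 0.
  move/eqP: (dGq 0); rewrite GFH mderivM mevalD !mevalM Fq mul0r addr0 mulf_eq0.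
  by rewrite (negPf dFq) => /eqP.
have trs' : t \in rs'.
  have [|t' t'rs <- //] := root rs'.
  move/eqP: Hq; rewrite mevalZ !mevalM rmorphXn /=.
  by rewrite !mulf_eq0 (negPf c0) expf_eq0 !(negPf (mq _)) andbF => /eqP.
have [|a Fa] := redG F (c *: (mpolyX C e *
    (V ^+ r * \prod_(t <- rem t rs') (U - t *: V)))).
  rewrite GFH /H (perm_big _ (perm_to_rem trs')) big_cons /= -/F -scalerAr -scalerAl.
  by congr (_ *: _); ring.
by move: dFq; rewrite Fa mderivC meval0 eqxx.
Qed.

(* Near a singular point fixed by the torus action, or on a coordinate line, the
   equation is read off its exponents; on the open torus orbit a singular point
   would make an orbit closure a multiple component. *)
Lemma diagonal_local_form n (w : 'I_3 -> C) G q :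
  (0 < n)%N -> poly_homogeneous n G -> G != 0 -> reduced_curve G ->
  (exists i, w i != 0) ->
  (forall m, m \in msupp G -> \sum_i w i * (m i)%:R = 0) ->
  singular_point G q -> local_form G q.
Proof.
move=> n0 hG G0 redG [iw w0] supp sq; have [[k qk] _ _] := sq.
(* For constant weights each exponent would have weight [n * w 0], which must be zero. *)
have wn : exists i, w i != w 0.
  apply/existsP; apply: contraNT w0 => /existsPn h.
  have wE i : w i = w 0 by apply/eqP; rewrite -[_ == _]negbK.
  move/eqP: (supp _ (mlead_supp G0)); under eq_bigr do rewrite wE.
  rewrite -mulr_sumr -natr_sum -mdegE (dhomog_mf hG (mlead_supp G0)) mulf_eq0 pnatr_eq0.
  by rewrite -[n == _]negbK -lt0n n0 orbF -(wE iw).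
have Ls m m' : m \in msupp G -> m' \in msupp G ->
    weight_lattice w (fun i => (m' i)%:Z - (m i)%:Z).
  move=> mG m'G; split; last first.
    under eq_bigr do rewrite rmorphB mulrBr /=.
    by rewrite sumrB !supp // subr0.
  rewrite sumrB -!(big_morph Posz PoszD (erefl (Posz 0))) -!mdegE.
  by rewrite (dhomog_mf hG mG) (dhomog_mf hG m'G) subrr.
(* Rank one: the i-th exponent is either constant on the support or determines the whole
   exponent. *)
have inj i : (forall m m', m \in msupp G -> m' \in msupp G -> m i = m' i) \/
    {in msupp G &, injective (fun m => m i)} /\
    (exists m m', [/\ m \in msupp G, m' \in msupp G & m i != m' i]).
  have [h|] := EM (forall m m', m \in msupp G -> m' \in msupp G -> m i = m' i).
    by left.
  move=> /existsNP[m1 /existsNP[m2 /not_implyP[m1G /not_implyP[m2G m12]]]]; right.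
  split; last by exists m1, m2; split=> //; exact/eqP.
  move=> m m' mG m'G mm'; apply/mnmP => j.
  have := weight_lattice_rank1 wn j i (Ls _ _ mG m'G) (Ls _ _ m1G m2G).
  rewrite mm' subrr mul0r => /eqP; rewrite mulf_eq0 !subr_eq0 => /orP[]/eqP.
    by case.
  by case=> E; case: m12.
have constE i : (forall m m', m \in msupp G -> m' \in msupp G -> m i = m' i) ->
    forall m, m \in msupp G -> m i = mlead G i.
  by move=> h m mG; apply: h => //; exact: mlead_supp.
have [/forallP qz|] := boolP [forall a : 'I_2, q (lift k a) == 0].
  apply: (local_form_coordinate_point hG G0 qk) => [a|m1 m2 m3 i j m1G m2G m3G].
    exact/eqP.
  exact: (weight_lattice_rank1 wn i j (Ls _ _ m1G m2G) (Ls _ _ m1G m3G)).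
rewrite negb_forall => /existsP[a qa].
(* Two coordinates of [q] are known to be nonzero, so here exactly one vanishes. *)
have [/existsP[i /eqP qi]|] := boolP [exists i, q i == 0].
  have ki : k != i by apply: contraNneq qk => ->; rewrite qi.
  have [/constE cst|[inji _]] := inj i; first exact: (local_form_binary hG G0 cst ki qk).
  apply: (local_form_transverse G0 inji qi) => l li.
  have [b ib _] := unlift_some ki.
  have ba : b = rev_ord a.
    have [ba|//] := ord2_cases a b.
    by move: qa; rewrite -ba -ib qi eqxx.
  case: (unliftP k l) li => [c|] -> // li.
  have [->//|cE] := ord2_cases a c.
  by rewrite ib ba cE eqxx in li.
rewrite negb_exists => /forallP qn0.
have [/constE cst|[_ m0]] := inj 0.
  exact: (local_form_binary hG G0 cst (k := 1)).
exfalso; exact: (torus_not_singular hG wn Ls m0 redG qn0 sq).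
Qed.
End DiagonalCase.

(** * Holomorphic charts *)

From mathcomp Require Import all_classical all_analysis.
Import numFieldNormedType.Exports.

Section LocalAnalysis.
Variable C : numClosedFieldType.
Local Open Scope classical_set_scope.

Lemma differentiable_expr (V : normedModType C) (f : V -> C) n (x : V) :
  differentiable f x -> differentiable (fun w => f w ^+ n) x.
Proof.
move=> df; rewrite (_ : (fun _ => _) = f ^+ n).
  by case: n => [|n]; [exact: differentiable_cst|exact: differentiableX].
by rewrite funeqE => w; elim: n => // n IH; rewrite !exprS IH.
Qed.

Lemma differentiable_meval (V : normedModType C) m (h : mpoly m C)
    (F : 'I_m -> V -> C) (x : V) :
  (forall i, differentiable (F i) x) ->
  differentiable (fun w => meval (F ^~ w) h) x.
Proof.
move=> dF; elim/mpolyind: h => [|c e q _ _ IH].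
  rewrite (_ : (fun _ => _) = cst 0) ?funeqE => [|w]; first exact: differentiable_cst.
  by rewrite meval0.
have dX : differentiable (fun w => \prod_i F i w ^+ e i) x.
  elim: index_enum => [|i s IHs].
    rewrite (_ : (fun _ => _) = cst 1) ?funeqE => [|w]; first exact: differentiable_cst.
    by rewrite big_nil.
  under eq_fun do rewrite big_cons.
  by apply: differentiableM => //; exact: differentiable_expr.
rewrite (_ : (fun _ => _) =
   cst c * (fun w => \prod_i F i w ^+ e i) + (fun w => meval (F ^~ w) q)).
  by apply: differentiableD => //; apply: differentiableM => //; exact: differentiable_cst.
by rewrite funeqE => w; rewrite mevalD mevalZ mevalX.
Qed.

Lemma differentiable_rV (V : normedModType C) m (F : 'I_m -> V -> C) (x : V) :
  (forall i, differentiable (F i) x) ->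
  differentiable (fun w => \row_i F i w : 'rV[C]_m) x.
Proof.
move=> dF.
rewrite (_ : (fun _ => _) =
    \sum_i (fun w => F i w *: (delta_mx 0 i : 'rV[C]_m))).
  by apply: differentiable_sum => i; exact: differentiableZl.
by rewrite funeqE => w; rewrite [LHS]row_sum_delta fct_sumE;
  apply: eq_bigr => i _; rewrite mxE.
Qed.

Lemma differentiable_near_neq0 (V : normedModType C) (f : V -> C) (x : V) :
  differentiable f x -> f x != 0 -> \forall y \near x, f y != 0.
Proof. by move=> /differentiable_continuous; exact: cvgr_neq0. Qed.

Lemma differentiable_lin m (c : C) (a : 'I_m -> C) (w : 'rV[C]_m) :
  differentiable (fun w : 'rV[C]_m => c + \sum_i a i * w ord0 i) w.
Proof.
rewrite (_ : (fun _ => _) =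
   cst c + \sum_i (cst (a i) * (fun w : 'rV[C]_m => w ord0 i : C))).
  apply: differentiableD; first exact: differentiable_cst.
  apply: differentiable_sum => i; apply: differentiableM.
    exact: differentiable_cst.
  exact: differentiable_coord.
by rewrite funeqE => y; rewrite [in RHS]/GRing.add /= fct_sumE.
Qed.

(* In the chart where the coordinate form [M 0] is 1, the other two forms are
   local coordinates at p, up to the projective change of chart. *)
Lemma quasi_homogeneous_chart n (g : mpoly 3 C) (p : 'I_3 -> C) (M : 'M[C]_3)
    (v h : mpoly 2 C) :
  poly_homogeneous n g -> M \in unitmx -> (exists i, p i != 0) ->
  (forall i, mxact M p (lift ord0 i) = 0) ->
  weighted_homogeneous h -> meval (fun=> 0) v != 0 ->
  (forall x, mxact M x ord0 = 1 -> meval x g =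
     meval (fun i => mxact M x (lift ord0 i)) v *
     meval (fun i => mxact M x (lift ord0 i)) h) ->
  quasi_homogeneous_at g p.
Proof.
move=> hg Mu [k pk0] Mp wh v0 gE; exists k; split=> //.
pose N := invmx M.
pose s := mxact M p ord0.
(* As [M p] is [s] times the first basis vector, [p] is [s] times the first column of the
   inverse. *)
have pE i : p i = s * N i ord0.
  rewrite -[LHS]mxact1 -(mulVmx Mu) -mxactM {1}/mxact big_ord_recl /= -/s big1.
    by rewrite addr0 mulrC.
  by move=> j _; rewrite Mp mulr0.
have s0 : s != 0 by apply: contraNneq pk0 => s0; rewrite pE s0 mul0r.
have Nk0 : N k ord0 != 0 by apply: contraNneq pk0 => Nk; rewrite pE Nk mulr0.
(* [X y] is the point whose coordinates with respect to [M] are (1, y); below, [Z w] is the point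
   [w] of the k-th chart and [Y w] its coordinates with respect to [M]. *)
pose X (y : 'rV[C]_2) i := N i ord0 + \sum_(j < 2) N i (lift ord0 j) * y ord0 j.
pose c (y : 'rV[C]_2) j : C := if unlift ord0 j is Some i then y ord0 i else 1.
have XE y i : X y i = mxact N (c y) i.
  rewrite /mxact big_ord_recl /c unlift_none mulr1; congr (_ + _).
  by apply: eq_bigr => j _; rewrite liftK.
pose Z (w : 'rV[C]_2) j : C :=
  if unlift k j is Some i then p j / p k + w ord0 i else 1.
pose Y w i := mxact M (Z w) i.
have YE w i : Y w i = s / p k * (i == ord0)%:R
    + \sum_(j < 2) M i (lift k j) * w ord0 j.
  have ZE j : Z w j = p j / p k +
      (if unlift k j is Some i then w ord0 i else 0).
    by rewrite /Z; case: unliftP => // ->; rewrite divff // addr0.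
  rewrite /Y /mxact; under eq_bigr do rewrite ZE mulrDr.
  rewrite big_split /=; congr (_ + _).
    under eq_bigr do rewrite mulrA.
    rewrite -mulr_suml -/(mxact M p i) mulrAC; congr (_ / _).
    case: (unliftP ord0 i) => [j|] ->; last by rewrite eqxx mulr1.
    by rewrite Mp mulr0.
  by rewrite (bigD1_ord k) //= unlift_none mulr0 add0r; apply: eq_bigr => j _;
    rewrite liftK.
(* The two transition maps between the charts, mutually inverse where the denominators do not
   vanish. *)
pose phi (y : 'rV[C]_2) : 'rV[C]_2 :=
  \row_i (X y (lift k i) * (X y k)^-1 - p (lift k i) / p k).
pose psi (w : 'rV[C]_2) : 'rV[C]_2 := \row_i (Y w (lift ord0 i) * (Y w ord0)^-1).
have dX i y : differentiable (X ^~ i) y by exact: differentiable_lin.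
have dY i y : differentiable (Y ^~ i) y.
  by under eq_fun do rewrite YE; exact: differentiable_lin.
have X0 i : X 0 i = N i ord0.
  by rewrite /X big1 ?addr0 // => j _; rewrite mxE mulr0.
have Y0 i : Y 0 i = s / p k * (i == ord0)%:R.
  by rewrite YE big1 ?addr0 // => j _; rewrite mxE mulr0.
have phi0 : phi 0 = 0.
  by apply/rowP => i; rewrite !mxE !X0 !pE -mulf_div divff // mul1r subrr.
have psi0 : psi 0 = 0.
  by apply/rowP => i; rewrite !mxE Y0 mulr0 mul0r.
have nX : \forall y \near (0 : 'rV[C]_2), X y k != 0.
  apply: differentiable_near_neq0; first exact: dX.
  by rewrite X0.
have nY : \forall w \near (0 : 'rV[C]_2), Y w ord0 != 0.
  apply: differentiable_near_neq0; first exact: dY.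
  by rewrite Y0 eqxx mulr1 mulf_neq0 // invr_eq0.
have dphi y : X y k != 0 -> differentiable phi y.
  move=> Xy; apply: differentiable_rV => i; apply: differentiableB.
    by apply: differentiableM => //; exact: differentiableV.
  exact: differentiable_cst.
have dpsi w : Y w ord0 != 0 -> differentiable psi w.
  move=> Yw; apply: differentiable_rV => i.
  by apply: differentiableM => //; exact: differentiableV.
have Zphi y : X y k != 0 -> Z (phi y) =1 (fun j => (X y k)^-1 * X y j).
  move=> Xy j; rewrite /Z; case: unliftP => [i ->|->]; last by rewrite mulVf.
  by rewrite mxE addrC subrK mulrC.
have MX y : mxact M (X y) =1 c y.
  by move=> i; rewrite (eq_mxact M (XE y)) mxactM mulmxV // mxact1.
have Yphi y i : X y k != 0 -> Y (phi y) i = (X y k)^-1 * c y i.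
  by move=> Xy; rewrite /Y (eq_mxact M (Zphi y Xy)) mxactZ MX.
have psiphi y : X y k != 0 -> psi (phi y) = y.
  move=> Xy; apply/rowP => i; rewrite mxE !Yphi // /c unlift_none liftK mulr1.
  by rewrite invrK mulrAC mulVf // mul1r.
have Xpsi w i : Y w ord0 != 0 -> X (psi w) i = (Y w ord0)^-1 * Z w i.
  move=> Yw; rewrite XE -[Z w i]mxact1 -(mulVmx Mu) -mxactM -mxactZ.
  apply: eq_mxact => j; rewrite -/(Y w j) /c.
  by case: unliftP => [l|] ->; rewrite ?mxE ?mulVf // mulrC.
have phipsi w : Y w ord0 != 0 -> phi (psi w) = w.
  move=> Yw; apply/rowP => i; rewrite mxE !Xpsi // {2}/Z unlift_none mulr1.
  by rewrite /Z liftK invrK mulrAC mulVf // mul1r addrC addKr.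
pose V (y : 'rV[C]_2) := meval (fun i => y ord0 i) v.
have dV y : differentiable V y.
  by apply: differentiable_meval => i; exact: differentiable_coord.
have V0 : V 0 != 0.
  suff -> : V 0 = meval (fun=> 0) v by [].
  by apply: meval_eq => i; rewrite mxE.
have nV' : \forall y \near (0 : 'rV[C]_2), V y != 0.
  exact: differentiable_near_neq0.
(* By homogeneity the change of chart rescales g by an n-th power; [u] cancels this factor and the
   unit [v]. *)
pose u w := (Y w ord0)^-1 ^+ n * (V (psi w))^-1.
have nV : \forall w \near (0 : 'rV[C]_2), V (psi w) != 0.
  have dVpsi : differentiable (V \o psi) 0.
    by apply: differentiable_comp => //; apply: dpsi; exact: nbhs_singleton nY.
  by apply: (differentiable_near_neq0 dVpsi); rewrite /= psi0.
have Y0n : Y 0 ord0 != 0 by exact: nbhs_singleton nY.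
exists u, phi, h; split=> //.
- split; last by rewrite /u psi0 mulf_neq0 ?expf_neq0 ?invr_eq0.
  near=> w.
  have Yw : Y w ord0 != 0 by near: w.
  have Vw : V (psi w) != 0 by near: w.
  have dV' : differentiable (V \o psi) w by apply: differentiable_comp => //; exact: dpsi.
  apply: differentiableM; last exact: (differentiableV dV' Vw).
  by apply: differentiable_expr; exact: differentiableV.
- exists psi; split; first by split.
  + exact: filterS (dphi) nX.
  + exact: filterS (dpsi) nY.
  + exact: filterS (psiphi) nX.
  + exact: filterS (phipsi) nY.
near=> y.
have Xy : X y k != 0 by near: y.
rewrite /u psiphi // Yphi // /c unlift_none mulr1 invrK.
rewrite /local_equation -/(Z (phi y)) (meval_eq _ (Zphi y Xy)).
rewrite (meval_homog _ _ hg) gE; last by rewrite MX /c unlift_none.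
have -> : meval (fun i => mxact M (X y) (lift ord0 i)) v = V y.
  by apply: meval_eq => i; rewrite MX /c liftK.
have -> : meval (fun i => mxact M (X y) (lift ord0 i)) h = meval (fun i => y ord0 i) h.
  by apply: meval_eq => i; rewrite MX /c liftK.
have Vy : V y != 0 by near: y.
by rewrite exprVn mulrACA divff ?expf_neq0 // mul1r mulKf.
Unshelve. all: by end_near.
Qed.

(** The shear [N] takes the k-th variable as zeroth form and moves q to the origin of its chart, so
    [N *m M] gives linear coordinates centred at p in which g has its local form. *)
Lemma local_form_quasi_homogeneous n (M : 'M[C]_3) G p :
  M \in unitmx -> poly_homogeneous n G -> (exists i, p i != 0) ->
  local_form G (mxact M p) -> quasi_homogeneous_at (lin_sub M G) p.
Proof.
move=> Mu hG p0 [k [v [h [qk wh v0 GE]]]].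
set q := mxact M p in qk GE.
pose N : 'M[C]_3 := \matrix_(i, l)
  if unlift 0 i is Some a then (l == lift k a)%:R - q (lift k a) / q k * (l == k)%:R
  else (l == k)%:R.
pose N' : 'M[C]_3 := \matrix_(l, i)
  if unlift k l is Some a then (i == lift 0 a)%:R + q l / q k * (i == 0)%:R
  else (i == 0)%:R.
have delta (f : 'I_3 -> C) l : \sum_j (j == l)%:R * f j = f l.
  rewrite (bigD1 l) //= eqxx mul1r big1 ?addr0 // => j /negPf ->.
  by rewrite mul0r.
have N0 x : mxact N x 0 = x k.
  by rewrite /mxact -[RHS]delta; apply: eq_bigr => j _; rewrite mxE unlift_none.
have NS x a : mxact N x (lift 0 a) = x (lift k a) - q (lift k a) / q k * x k.
  rewrite /mxact -[x k]delta -[x (lift k a)]delta mulr_sumr -sumrB.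
  by apply: eq_bigr => j _; rewrite mxE liftK mulrBl mulrA.
have N'k x : mxact N' x k = x 0.
  by rewrite /mxact -[RHS]delta; apply: eq_bigr => j _; rewrite mxE unlift_none.
have N'S x a : mxact N' x (lift k a) = x (lift 0 a) + q (lift k a) / q k * x 0.
  rewrite /mxact -[x 0]delta -[x (lift 0 a)]delta mulr_sumr -big_split.
  by apply: eq_bigr => j _; rewrite mxE liftK mulrDl mulrA.
have N'N x : mxact N' (mxact N x) =1 x.
  move=> l; case: (unliftP k l) => [a|] ->; last by rewrite N'k N0.
  by rewrite N'S NS N0 subrK.
(* For square matrices the one-sided inverse [N'] suffices. *)
have Nu : N \in unitmx.
  have [] // := @mulmx1_unit _ _ N' N.
  apply/matrixP => i j; transitivity (mxact (N' *m N) (fun l => (l == j)%:R) i).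
    rewrite /mxact -[LHS](delta (fun l => (N' *m N) i l)).
    by apply: eq_bigr => l _; rewrite mulrC.
  by rewrite -mxactM N'N mxE.
apply: (quasi_homogeneous_chart (homog_lin_sub M hG) (M := N *m M) _ _ _ wh v0) => //.
- by rewrite unitmx_mul Nu.
- by move=> a; rewrite -mxactM -/q NS divfK ?subrr.
move=> x; rewrite -mxactM N0 => xk; rewrite meval_lin_sub.
set z := mxact M x in xk *.
rewrite (meval_eq _ (v2 := chart_point q k (fun a => z (lift k a) - q (lift k a) / q k))).
  rewrite GE; congr (_ * _); apply: meval_eq => a;
  by rewrite -mxactM -/z NS xk mulr1.
move=> l; rewrite /chart_point; case: unliftP => [a|] -> //.
by rewrite subrK.
Qed.
End LocalAnalysis.

(** * The main theorem *)

Section Main.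
Variable C : numClosedFieldType.

Lemma singular_point_lin_sub (N M : 'M[C]_3) g p : N *m M = 1%:M -> M \in unitmx ->
  singular_point g p -> singular_point (lin_sub N g) (mxact M p).
Proof.
move=> NM Mu [[i pi] gp dgp].
have NMp : mxact N (mxact M p) =1 p by move=> j; rewrite mxactM NM mxact1.
split.
- apply/existsP; apply: contraNT pi => /existsPn h.
  rewrite -NMp [mxact N _ i]/mxact big1 // => j _.
  by have /negPn/eqP -> := h j; rewrite mulr0.
- by rewrite meval_lin_sub (meval_eq _ NMp).
move=> j; rewrite mderiv_lin_sub raddf_sum big1 // => k _ /=.
by rewrite mevalZ meval_lin_sub (meval_eq _ NMp) dgp mulr0.
Qed.

Lemma linear_syzygy_ploski n (g : mpoly 3 C) :
  plane_curve n g -> reduced_curve g -> ~ concurrent_lines g ->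
  has_linear_syzygy g ->
  (exists p, singular_point g p /\ ~ quasi_homogeneous_at g p) ->
  even_ploski n g \/ odd_ploski n g.
Proof.
move=> [n0 g0 hg] redg ncg [v [hv [iv v0] syz]] [p [sp nqh]].
have [A vA] := linear_form_coordinate hv.
have dg : linear_derivation A g = 0.
  by rewrite -[RHS]syz; apply: eq_bigr => i _; rewrite vA.
have A0 : A != 0.
  apply: contraNneq v0 => A0; rewrite vA A0 /coordinate big1 // => j _.
  by rewrite mxE scale0r.
have [M [T [Mu MA JT]]] := jordanizable_closed A.
pose G := lin_sub (invmx M) g.
have gE : g = lin_sub M G by rewrite lin_subVK.
have Nu : invmx M \in unitmx by rewrite unitmx_inv.
have hG : poly_homogeneous n G by exact: homog_lin_sub.
have G0 : G != 0 by apply: contraNneq g0 => G0; rewrite gE G0 raddf0.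
have redG : reduced_curve G by exact: reduced_lin_sub.
have ncG : ~ concurrent_lines G.
  by move=> cG; apply: ncg; rewrite gE; exact: concurrent_lin_sub.
have dG : linear_derivation T G = 0.
  apply: (can_inj (lin_subK Mu)); rewrite -(linear_derivation_lin_sub _ MA) -gE dg.
  by rewrite raddf0.
have sG : singular_point G (mxact M p).
  by apply: singular_point_lin_sub => //; exact: mulVmx.
case: JT => [[a [b [c TE]]]|[a [c TE]]|[a TE]]; rewrite TE in dG.
- exfalso; apply: nqh; rewrite gE.
  have [p0 _ _] := sp; apply: local_form_quasi_homogeneous => //.
    exact: hG.
  (* The eigenvalues are the weights: being killed by the diagonal field means that each exponent of
     [G] has weight zero, and [w] is nonzero because [A] is. *)
  pose w (i : 'I_3) : C := nth 0 [:: a; b; c] i.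
  apply: (diagonal_local_form (w := w) n0 hG G0 redG _ _ sG).
    apply/existsP; apply: contraNT A0 => /existsPn h.
    have z i : w i = 0 by apply/eqP; rewrite -[_ == _]negbK.
    have T0 : T = 0.
      rewrite TE (z 0 : a = 0) (z 1 : b = 0) (z 2%:R : c = 0).
      by apply/matrixP; apply: ord3P; apply: ord3P; rewrite !mxE.
    by rewrite -[A]mul1mx -(mulVmx Mu) -mulmxA MA T0 mul0mx mulmx0.
  move=> m; rewrite mcoeff_msupp => Gm.
  have := mcoeff_linear_derivation a b c 0 0 m G.
  rewrite dG mcoeff0 !mul0r !addr0 => /esym/eqP; rewrite mulf_eq0 (negPf Gm) orbF.
  by rewrite sum3E => /eqP.
- exfalso; apply: ncG; apply: (concurrent_binary_form n0 hG G0).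
  exact: jordan_block_coeff0 dG.
have a0 := jordan3_eigenvalue0 n0 hG G0 dG; rewrite a0 in dG.
have [//|[s [c [s0 us c0 GE]]]] := jordan3_ploski n0 hG G0 redG dG.
have gE2 :
    g = c *: (coordinate M 2%:R ^+ odd n * \prod_(t <- s) hyperosculating_conic M t).
  rewrite gE GE linearZ /= rmorphM rmorphXn rmorph_prod /= lin_sub_var.
  by under [in LHS]eq_bigr do rewrite hyperosculating_lin_sub mul1mx.
(* The parity of n decides whether the common tangent z = 0 is a component. *)
case: (boolP (odd n)) => on; [right|left]; (split; first by []).
  by exists M, s, c; split=> //; rewrite [LHS]gE2 on expr1.
by exists M, s, c; split=> //; rewrite [LHS]gE2 (negPf on) expr0 mul1r.
Qed.
End Main.

Theorem theorem8p4 (R : realType) (n : nat) (g : mpoly 3 R[i]) :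
  plane_curve n g ->
  reduced_curve g ->
  free_curve g ->
  ~ concurrent_lines g ->
  has_linear_syzygy g ->
  (exists p : 'I_3 -> R[i], singular_point g p /\ ~ quasi_homogeneous_at g p) ->
  even_ploski n g \/ odd_ploski n g.
Proof.
by move=> plane red _; exact: linear_syzygy_ploski.
Qed.
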